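(* Assume $\mathsf{MA}_{\aleph_1}$. Let $C$ and $C'$ be $\aleph_1$-dense Countryman lines such that $C'\preceq C$, and let $D$ be a decomposition for $C$ and $D'$ a decomposition for $C'$. If for some club $E\subseteq\omega_1$ we have $\mathscr{L}(C,D)\cap E\subseteq\hat{\mathscr{L}}(C',D')$ and $\mathscr{R}(C,D)\cap E\subseteq\hat{\mathscr{R}}(C',D')$, then $C'\trianglelefteq C$, i.e. there is an epimorphism from $C$ onto $C'$.
   Context: An epimorphism from a linear order $A$ onto a linear order $B$ is a surjective monotone map $f:A\to B$ ($x\le y$ implies $f(x)\le f(y)$). Write $B\trianglelefteq A$ if $B=\varnothing$ or there is an epimorphism from $A$ onto $B$; write $B\preceq A$ if $B$ embeds into $A$, i.e. there is a monotone injection $B\to A$. A nonempty linear order $A$ is $\aleph_1$-dense if it has no left or right endpoint and $[a,b]_A$ has size $\aleph_1$ for all $a<_A b$. A Countryman line is an uncountable linear order $C$ such that $C^2$, with the coordinatewise product order, is a union of countably many chains. Every Countryman line is an Aronszajn line, where an Aronszajn line is an uncountable linear order containing no copy of $\omega_1$, $\omega_1^{\star}$ (the reverse of $\omega_1$), or any uncountable set of reals; Aronszajn lines have size $\aleph_1$. A decomposition for an Aronszajn line $A$ is a $\subseteq$-increasing sequence $D=\langle D_\xi:\xi<\omega_1\rangle$ of countable subsets of $A$ which covers $A$ and is continuous ($D_\xi=\bigcup_{\eta<\xi}D_\eta$ for limit $\xi$). An interval of $A$ is a nonempty convex subset. The complementary intervals of $A\setminus D_\xi$ are the intervals of $A$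 that are maximal with respect to not having points in $D_\xi$. An interval has a left (right) endpoint if it has a minimum (maximum). $\mathscr{L}(A,D)$ (resp. $\hat{\mathscr{L}}(A,D)$) is the set of $\xi<\omega_1$ such that some (resp. every) complementary interval of $A\setminus D_\xi$ has a left endpoint; $\mathscr{R}(A,D)$ and $\hat{\mathscr{R}}(A,D)$ are defined in the same way with right endpoints. *)

(* Defs.v *)
From HB Require Import structures.
From mathcomp Require Import all_boot all_order all_classical.
From mathcomp Require wochoice.

Set Implicit Arguments.
Unset Strict Implicit.
Unset Printing Implicit Defensive.

Import Order.TTheory.
Local Open Scope classical_set_scope.
Local Open Scope card_scope.
Local Open Scope order_scope.

Definition has_left_endpoint d (T : porderType d) (X : set T) : Prop :=
  X `&` lbound X !=set0.

Definition has_right_endpoint d (T : porderType d) (X : set T) : Prop :=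
  X `&` ubound X !=set0.

(* [is_omega1 W]: the order type of [W] is omega_1, i.e. [W] is an uncountable
   well-order all of whose proper initial segments are countable; this determines
   [W] up to a unique isomorphism, and [omega1_exists] below provides one. *)
Definition is_omega1 d (W : orderType d) : Prop :=
  [/\ forall X : set W, X !=set0 -> has_left_endpoint X,
      ~ countable [set: W]
    & forall w : W, countable [set v | v < w]].

Lemma uncountable_set_nat : ~ countable [set: set nat].
Proof.
move=> /countable_injP[f finj].
pose D : set nat := [set n | exists2 X : set nat, f X = n & ~ X n].
have [DfD|nDfD] := pselect (D (f D)); last by apply: (nDfD); exists D.
case: (DfD) => X fXD; suff -> : X = D by [].
by apply: finj => //; rewrite inE.
Qed.

Lemma omega1_exists : exists W : orderType (Order.Disp tt tt), is_omega1 W.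
Proof.
pose T : choiceType := set nat.
have [R Rwo] := wochoice.well_ordering_principle T.
have Rmin (A : set T) : A !=set0 -> exists2 z, A z & forall x, A x -> R z x.
  move=> [a Aa]; have [|z [[/asboolP Az zlb] _]] := Rwo [pred x | `[< A x >]].
    by exists a; apply/asboolP.
  by exists z => // x Ax; apply: zlb; apply/asboolP.
have Rwoc : wochoice.wo_chain R predT by move=> A _; apply: Rwo.
have Rtot : total R by move=> x y; apply: (wochoice.wo_chainW Rwoc).
have Ranti : antisymmetric R.
  by move=> x y; apply: (wochoice.wo_chain_antisymmetric Rwoc).
have Rtrans : transitive R.
  move=> y x z Rxy Ryz.
  have [|w + wlb] := Rmin [set t | t = x \/ t = y \/ t = z].
    by exists x; left.
  case=> [|[|]] wE; subst w; first by apply: wlb; right; right.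
  - suff -> : x = y by [].
    by apply: Ranti; rewrite Rxy wlb//; left.
  - suff -> : z = y by [].
    by apply: Ranti; rewrite Ryz wlb//; right; left.
pose I x : set T := [set y | R y x /\ y <> x].
have [S [Scount Sunc]] : exists S : {pred T},
    (forall x, S x -> countable (I x)) /\ ~ countable [set x | S x].
  have [[x0 x0P]|nx] := pselect (exists x, ~ countable (I x)); last first.
    exists (fun=> true); split; last by rewrite [X in countable X](_ : _ = setT)//;
      [exact: uncountable_set_nat | exact/seteqP].
    by move=> x _; apply: contrapT => xP; apply: nx; exists x.
  have [|m mP mlb] := Rmin [set x | ~ countable (I x)]; first by exists x0.
  exists (fun y => `[< I m y >]); split.
    move=> x /asboolP[Rxm xm]; apply: contrapT => /mlb Rmx.
    by apply: xm; apply: Ranti; rewrite Rxm.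
  by rewrite [X in countable X](_ : _ = I m)//; apply/seteqP; split=> y /asboolP.
pose U := {x : T | S x}.
pose le : rel U := fun u v => R (val u) (val v).
have lexx : reflexive le by move=> x; rewrite -[le x x]orbb Rtot.
have le_an : antisymmetric le by move=> x y /Ranti/val_inj.
have le_tr : transitive le by move=> y x z; apply: Rtrans.
have le_to : total le by move=> x y; apply: Rtot.
pose P : porderType (Order.Disp tt tt) := HB.pack U
  (Order.Le_isPOrder.Build (Order.Disp tt tt) U lexx le_an le_tr).
pose W : orderType (Order.Disp tt tt) := HB.pack P
  (Order.POrder_isTotal.Build (Order.Disp tt tt) P le_to).
have valI (A : set U) : countable (val @` A) -> countable A.
  move=> /countable_injP[f finj]; apply/countable_injP.
  exists (f \o val) => x y; rewrite !inE => Ax Ay /= fxy.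
  by apply: val_inj; apply: finj => //; rewrite inE; [exists x|exists y].
exists W; split.
- move=> X [x Xx]; have [|z [u Xu <-] zlb] := Rmin (val @` X).
    by exists (val x); exists x.
  by exists u; split=> // v Xv; apply: zlb; exists v.
- move=> Wc; apply: Sunc; apply: sub_countable Wc.
  apply: card_le_trans (card_image_le (val : U -> T) [set: U]).
  by apply: subset_card_le => x /= Sx; exists (exist _ x Sx).
- move=> w; apply: valI; apply: sub_countable (Scount (val w) (valP w)).
  apply: subset_card_le => _ [v + <-] => /=.
  rewrite lt_neqAle => /andP[/eqP vw Rvw]; split; first exact: Rvw.
  by move=> /val_inj.
Qed.

(* The least element (the ordinal 0) does not count as a limit. *)
Definition is_limit d (W : orderType d) (w : W) : Prop :=
  (exists v, v < w) /\ forall v, v < w -> exists2 u, v < u & u < w.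

Definition is_club d (W : orderType d) (E : set W) : Prop :=
  (forall v, exists2 u, v <= u & E u) /\
  (forall w, is_limit w ->
     (forall v, v < w -> exists2 u, v <= u < w & E u) -> E w).

Section Forcing.
Context d (P : preorderType d).

Definition compatible (p q : P) : Prop := exists2 r, r <= p & r <= q.

Definition is_antichain (A : set P) : Prop :=
  forall p q, A p -> A q -> p <> q -> ~ compatible p q.

Definition ccc : Prop := forall A : set P, is_antichain A -> countable A.

Definition forcing_dense (X : set P) : Prop :=
  forall p, exists2 q, q <= p & X q.

Definition forcing_filter (G : set P) : Prop :=
  [/\ G !=set0,
      forall p q, G p -> p <= q -> G q
    & forall p q, G p -> G q -> exists2 r, G r & r <= p /\ r <= q].

End Forcing.

(* [W] is a copy of omega_1, used only as a set of size aleph_1. *)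
Definition MA_aleph1 dW (W : orderType dW) : Prop :=
  forall d (P : preorderType d), [set: P] !=set0 -> ccc P ->
  forall F : set (set P), F #<= [set: W] ->
    (forall X, F X -> forcing_dense X) ->
  exists2 G : set P, forcing_filter G & forall X, F X -> G `&` X !=set0.

Definition embeds dB dA (B : orderType dB) (A : orderType dA) : Prop :=
  exists2 f : B -> A, injective f & {homo f : x y / x <= y}.

Definition is_epimorphism dA dB (A : orderType dA) (B : orderType dB)
    (f : A -> B) : Prop :=
  (forall y, exists x, f x = y) /\ {homo f : x y / x <= y}.

Definition epi_image dB dA (B : orderType dB) (A : orderType dA) : Prop :=
  [set: B] = set0 \/ exists f : A -> B, is_epimorphism f.

Definition aleph1_dense dW (W : orderType dW) d (A : orderType d) : Prop :=
  [/\ [set: A] !=set0,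
      ~ has_left_endpoint [set: A],
      ~ has_right_endpoint [set: A]
    & forall a b : A, a < b -> [set x | a <= x <= b] #= [set: W]].

(* [C *p C] carries the coordinatewise product order. *)
Definition is_countryman d (C : orderType d) : Prop :=
  ~ countable [set: C] /\
  exists2 K : nat -> set (C *p C),
    forall n, total_on (K n) (fun p q => p <= q) & \bigcup_n K n = setT.

Definition is_decomposition dW (W : orderType dW) d (A : orderType d)
    (D : W -> set A) : Prop :=
  [/\ forall w, countable (D w),
      {homo D : v w / v <= w >-> v `<=` w},
      \bigcup_w D w = setT
    & forall w, is_limit w -> D w = \bigcup_(v in [set v | v < w]) D v].

Definition is_interval d (A : orderType d) (I : set A) : Prop :=
  I !=set0 /\ forall x y z, I x -> I y -> x <= z <= y -> I z.

(* [I] is a complementary interval of [A \ X]. *)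
Definition complementary_interval d (A : orderType d) (X I : set A) : Prop :=
  [/\ is_interval I, I `&` X = set0
    & forall J, is_interval J -> J `&` X = set0 -> I `<=` J -> J = I].

Section EndpointSets.
Context dW (W : orderType dW) d (A : orderType d) (D : W -> set A).

Definition some_left : set W :=
  [set w | exists2 I, complementary_interval (D w) I & has_left_endpoint I].

Definition every_left : set W :=
  [set w | forall I, complementary_interval (D w) I -> has_left_endpoint I].

Definition some_right : set W :=
  [set w | exists2 I, complementary_interval (D w) I & has_right_endpoint I].

Definition every_right : set W :=
  [set w | forall I, complementary_interval (D w) I -> has_right_endpoint I].

End EndpointSets.

(* Main.v *)
From HB Require Import structures.
Require Import Defs.
From mathcomp Require Import all_boot all_order all_classical.

(** Martin's axiom is applied to finite approximations of the epimorphism: finite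
    sets of pairs (x, y) in C x C', any two of which are [admissible] together.
    A suitable filter then yields a set of pairs that is total on C, onto C' and
    monotone, hence a function, and this is the epimorphism.

    Admissibility is measured along a club of levels w, those at which the
    countable sets D w and D' w are closed under enough countable operations
    ([levels]).  Two points are separated at level w when D w meets the closed
    interval between them ([sep]).  Besides monotonicity, two pairs (x, y) and
    (u, v) must satisfy, at every level: if x and u are separated, so are y and
    v; and if y and v are separated, then x and u are separated unless y = v.
    So the map respects the trees of complementary intervals of the two lines,
    but may collapse an interval of C to one point of C'.  Finally, when y has
    not yet appeared at level w and x is the left or right end of its
    complementary interval, y must be the same end of its own.

    The chain condition comes from the Countryman property.  Since C' embeds
    into C, the product C x C' is covered by countably many chains, and for two
    pairs in one chain the separation conditions hold automatically at closed
    levels ([same_chain_admissible]).  Given uncountably many finite conditions,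
    take a closed level d and a condition p not contained in it.  Some level
    g < d already separates all the points of p that d separates.  Reflection
    gives a condition q inside level d whose i-th pair lies in the same chain as
    the i-th pair of p and in the same complementary intervals at level g; then
    p and q are compatible ([admissible_transfer], [admissible_knaster]).  There
    are only countably many such patterns over g because a Countryman line
    contains no uncountable separable suborder ([same_code]); the closed levels
    exist because it contains no copy of omega_1 or its reverse
    ([countryman_cofinal], [countryman_coinitial]).

    The density arguments let the map lower levels.  To put y in the range,
    choose x of higher level than y, so that the endpoint condition is vacuous
    ([extend_ran]).  To put x in the domain, let h be the last level at which x
    is not separated from the domain and choose y at the level just after h
    ([extend_dom]).  The only obstruction is that x may be an endpoint of its
    interval at h, so that y has to be an endpoint too: it exists because, on a
    club, one endpoint among the intervals of C forces endpoints of that side in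
    all the intervals of C'. *)

Set Implicit Arguments.
Unset Strict Implicit.
Unset Printing Implicit Defensive.

Import Order.TTheory.
Local Open Scope classical_set_scope.
Local Open Scope card_scope.
Local Open Scope order_scope.

(** * Finite and countable sets *)

Lemma countable_setU T (A B : set T) :
  countable A -> countable B -> countable (A `|` B).
Proof.
move=> Ac Bc; rewrite -bigcup2E; apply: bigcup_countable => // -[|[|n]] _ //=.
Qed.

Lemma countable_seqs (T : choiceType) (X : set T) :
  countable X -> countable [set p : seq T | forall t, t \in p -> X t].
Proof.
move=> /countable_injP[e einj]; apply/countable_injP.
exists (pickle \o map e) => p q; rewrite !inE /= => pX qX.
move=> /(pcan_inj pickleK) pq; apply: (inj_in_map (A := mem X)) pq.
- by move=> s t sX tX; apply: einj.
- by apply/allP => t tp; apply/mem_set/pX.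
- by apply/allP => t tq; apply/mem_set/qX.
Qed.

Lemma countable_mem (T : eqType) (p : seq T) : countable [set t | t \in p].
Proof.
apply/countable_injP; exists (index^~ p) => s t; rewrite !inE => sp tp st.
by rewrite -(nth_index s sp) st nth_index.
Qed.

Section Selection.
Context (T : eqType) d (O : orderType d) (g : T -> O).

Lemma seq_argmax (p : seq T) : p != [::] ->
  exists2 t, t \in p & forall s, s \in p -> g s <= g t.
Proof.
elim: p => // a p IH _; have [->|/IH[t tp tmax]] := eqVneq p [::].
  by exists a; rewrite ?mem_head// => s; rewrite inE => /eqP ->.
have [at_|ta] := leP (g a) (g t).
  exists t; first by rewrite inE tp orbT.
  by move=> s; rewrite inE => /orP[/eqP ->//|]; apply: tmax.
exists a; first exact: mem_head.
move=> s; rewrite inE => /orP[/eqP ->//|/tmax h].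
by apply: le_trans h (ltW ta).
Qed.

End Selection.

Lemma seq_argmin (T : eqType) d (O : orderType d) (g : T -> O) (p : seq T) :
  p != [::] -> exists2 t, t \in p & forall s, s \in p -> g t <= g s.
Proof. exact: (@seq_argmax T _ O^d g p). Qed.

(** A finite conjunction that holds at a limit holds at an earlier stage. *)
Lemma seq_reflect dW (W : orderType dW) (T : eqType) (P : T -> W -> Prop) d
    (p : seq T) : (exists v, v < d) ->
    (forall t v w, v <= w -> P t v -> P t w) ->
    (forall t, t \in p -> exists2 v, v < d & P t v) ->
  exists2 v, v < d & forall t, t \in p -> P t v.
Proof.
move=> d0 Pmon; elim: p => [|a p IH] Pp.
  by have [v vd] := d0; exists v.
have [|v vd vP] := IH; first by move=> t tp; apply: Pp; rewrite inE tp orbT.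
have [|u ud uP] := Pp a; first exact: mem_head.
exists (Order.max u v); first by rewrite gt_max ud.
move=> t; rewrite inE => /orP[/eqP ->|/vP]; last first.
  by apply: Pmon; rewrite le_max lexx orbT.
by apply: Pmon uP; rewrite le_max lexx.
Qed.

(** * The first uncountable ordinal *)

Section Omega1.
Context dW (W : orderType dW) (omW : is_omega1 W).

Lemma omega1_least (Q : set W) :
  Q !=set0 -> exists2 m, Q m & forall v, Q v -> m <= v.
Proof. by case: omW => + _ _ => /(_ Q) h /h[m [Qm mlb]]; exists m. Qed.

Lemma omega1_bound (X : set W) :
  countable X -> exists w, forall v, X v -> v < w.
Proof.
case: omW => _ Wunc Wini Xc; apply: contrapT => nb; apply: Wunc.
apply: (@sub_countable _ _ _ (\bigcup_(v in X) ([set u | u < v] `|` [set v]))).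
  apply: subset_card_le => w _; apply: contrapT => nw; apply: nb; exists w.
  move=> v Xv; rewrite ltNge; apply/negP; rewrite le_eqVlt => /orP wv.
  by apply: nw; exists v => //; case: wv => [/eqP ->|]; [right|left].
apply: bigcup_countable => // v _.
by apply: countable_setU; [exact: Wini | exact: countable1].
Qed.

Lemma omega1_above (w : W) : exists v, w < v.
Proof. by have [v +] := omega1_bound (countable1 w) => /(_ w erefl); exists v. Qed.

(** The regularity of omega_1, in the form in which every countable closing-off
    below is carried out: countably many requirements, each met from some stage on,
    are all met at one stage. *)
Lemma omega1_uniform T (X : set T) (P : T -> W -> Prop) : countable X ->
    (forall c v w, v <= w -> P c v -> P c w) ->
    (forall c, X c -> exists w, P c w) ->
  exists w, forall c, X c -> P c w.
Proof.
move=> Xc Pmon PX.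
have [w0 _] : exists w : W, True.
  by have [w _] := omega1_bound (countable0 W); exists w.
have /choice[g gP] : forall c, exists w, X c -> P c w.
  move=> c; have [Xc'|nXc] := pselect (X c); last by exists w0.
  by have [w Pw] := PX c Xc'; exists w.
have [|w wP] := @omega1_bound (g @` X).
  by apply: sub_countable Xc; exact: card_image_le.
exists w => c Xc'; apply: Pmon (gP c Xc'); apply/ltW/wP; by exists c.
Qed.

Definition closed_below (F : W -> W) (w : W) : Prop :=
  is_limit w /\ forall v, v < w -> F v < w.

(** The closure points of any function on omega_1 are unbounded: iterate the
    function from [w0] and take the supremum of the omega many values. *)
Lemma closed_below_exists F w0 : exists2 w, w0 < w & closed_below F w.
Proof.
have /choice[g gP] : forall u, exists u', u < u' /\ forall v, v <= u -> F v < u'.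
  move=> u; have [|w wP] :=
    @omega1_bound ((F @` ([set v | v < u] `|` [set u])) `|` [set u]).
    apply: countable_setU; last exact: countable1.
    apply: (@sub_countable _ _ _ ([set v | v < u] `|` [set u])).
      exact: card_image_le.
    by apply: countable_setU; [case: omW | exact: countable1].
  exists w; split; first by apply: wP; right.
  move=> v; rewrite le_eqVlt => /orP vu; apply: wP; left; exists v => //.
  by case: vu => [/eqP ->|]; [right|left].
pose h n := iter n g w0.
have hS n : h n < h n.+1 by case: (gP (h n)).
have [w hw wl] : exists2 w, (forall n, h n < w) &
    forall v, (forall n, h n < v) -> w <= v.
  apply: omega1_least; have [|w wP] := @omega1_bound (range h).
    by apply: (@sub_countable _ _ _ [set: nat]); first exact: card_image_le.
  by exists w => n; apply: wP; exists n.
have below v : v < w -> exists n, v <= h n.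
  move=> vw; apply: contrapT => nv; move: vw; rewrite ltNge => /negP; apply.
  apply: wl => n; rewrite ltNge; apply/negP => vn; apply: nv; by exists n.
exists w; first exact: (hw 0).
split; first split.
- by exists w0; exact: (hw 0).
- by move=> v /below[n vn]; exists (h n.+1) => //; apply: le_lt_trans (hS n).
- move=> v /below[n vn]; apply: lt_trans (hw n.+1).
  by case: (gP (h n)) => _; apply.
Qed.

(** Attach to a point of the union a limit stage l at which it is present and its
    index n in an enumeration of that stage; the n-th successor of l determines both
    l and n, because limits are not successors. *)
Lemma card_le_omega1 U (B : W -> set U) :
    (forall w, countable (B w)) -> {homo B : v w / v <= w >-> v `<=` w} ->
  \bigcup_w B w #<= [set: W].
Proof.
move=> Bc Bmon.
have /choice[s sP] : forall v : W, exists u, v < u /\ forall u', v < u' -> u <= u'.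
  move=> v; have [|u vu ul] := @omega1_least [set u | v < u].
    exact: omega1_above.
  by exists u.
have sinj : injective s.
  move=> u v suv; case: (ltgtP u v) => // uv.
    by have := (sP u).2 v uv; rewrite suv leNgt (sP v).1.
  by have := (sP v).2 u uv; rewrite -suv leNgt (sP u).1.
have limNs w : is_limit w -> forall v, s v <> w.
  move=> [_ wl] v svw.
  have [|u vu uw] := wl v; first by rewrite -svw; case: (sP v).
  by have := (sP v).2 u vu; rewrite svw leNgt uw.
have iter_inj m : forall n w w', is_limit w -> is_limit w' ->
    iter m s w = iter n s w' -> w = w' /\ m = n.
  elim: m => [|m IH] [|n] w w' lw lw' //=.
  - by move=> E; case: (limNs _ lw (iter n s w')).
  - by move=> E; case: (limNs _ lw' (iter m s w)).
  - by move=> /sinj/IH[]// -> ->.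
have /choice[e eP] : forall w, exists f : U -> nat, {in B w &, injective f}.
  by move=> w; apply/countable_injP.
have [v0 _] := omega1_bound (countable0 W).
have /choice[l lP] : forall u, exists w,
    is_limit w /\ ((\bigcup_w B w) u -> B w u).
  move=> u; have [[v _ Bvu]|nu] := pselect ((\bigcup_w B w) u).
    have [w vw [wl _]] := closed_below_exists id v; exists w; split => // _.
    by apply: Bmon Bvu; apply: ltW.
  by have [w _ [wl _]] := closed_below_exists id v0; exists w.
have finj : {in \bigcup_w B w &, injective (fun u => iter (e (l u) u) s (l u))}.
  move=> u v; rewrite !inE => Bu Bv /iter_inj[].
  - by case: (lP u).
  - by case: (lP v).
  move=> luv; rewrite -luv; apply: eP; rewrite inE.
    by apply: (lP u).2.
  by rewrite luv; apply: (lP v).2.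
have := inj_card_eq finj; rewrite card_eq_le => /andP[_ le].
by apply: card_le_trans le _; exact: card_leT.
Qed.

End Omega1.

(** * Countryman lines *)

Section Countryman.
Context d (C : orderType d).

Definition chain_rel d' (C' : orderType d') (R : C -> C' -> Prop) : Prop :=
  forall x y x' y', R x y -> R x' y' ->
    (x <= x' /\ y <= y') \/ (x' <= x /\ y' <= y).

(** The Countryman property, with the product order spelled out. *)
Definition chain_cover (K : nat -> C -> C -> Prop) : Prop :=
  (forall n, chain_rel (K n)) /\ forall x y, exists n, K n x y.

End Countryman.

Lemma countryman_cover d (C : orderType d) :
  is_countryman C -> exists K : nat -> C -> C -> Prop, chain_cover K.
Proof.
move=> [_ [K Kch Kcov]]; exists (fun n x y => K n (x, y)); split.
  move=> n x y x' y' Kxy Kxy'.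
  by have [/andP[]|/andP[]] := Kch n (x, y) (x', y') Kxy Kxy'; [left|right].
move=> x y; have : [set: C *p C] (x, y) by [].
by rewrite -Kcov => -[n _ Kn]; exists n.
Qed.

(** No copy of omega_1.  If X had no countable cofinal subset, then for each a some
    chain would contain (a, b) for cofinally many b in X.  Two elements a < a' of X
    then use the same chain, as X is uncountable; choosing b' for a' first and
    then a larger b for a puts two incomparable pairs in it. *)
Lemma countryman_cofinal d (C : orderType d) (K : nat -> C -> C -> Prop)
    (X : set C) : chain_cover K ->
  exists S : set C, [/\ countable S, S `<=` X &
    forall x, X x -> exists2 s, S s & x <= s].
Proof.
move=> [Kch Kcov]; apply: contrapT => nS.
have unb (S : set C) : countable S -> S `<=` X ->
    exists2 x, X x & forall s, S s -> s < x.
  move=> Sc SX; apply: contrapT => nx; apply: nS; exists S; split=> // x Xx.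
  apply: contrapT => ns; apply: nx; exists x => // s Ss.
  by rewrite ltNge; apply/negP => xs; apply: ns; exists s.
(* n a is a chain whose fibre over a meets X cofinally *)
have /choice[n nP] : forall a, exists n, forall z, X z ->
    exists b, [/\ X b, K n a b & z < b].
  move=> a; apply: contrapT => nn.
  have /choice[z zP] : forall n, exists z, X z /\
      forall b, X b -> K n a b -> b <= z.
    move=> n; apply: contrapT => nz; apply: nn; exists n => z Xz.
    apply: contrapT => nb; apply: nz; exists z; split=> // b Xb Kb.
    by rewrite leNgt; apply/negP => zb; apply: nb; exists b.
  have [| |x Xx zx] := unb (range z).
  - by apply: (@sub_countable _ _ _ [set: nat]); first exact: card_image_le.
  - by move=> _ [m _ <-]; case: (zP m).
  have [m Km] := Kcov a x.
  by have := (zP m).2 x Xx Km; rewrite leNgt zx//; exists m.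
have Xunc : ~ countable X.
  by move=> Xc; have [x Xx /(_ x Xx)] := unb X Xc (@subset_refl _ _); rewrite ltxx.
apply: Xunc; apply/countable_injP; exists n.
have key a a' : X a -> a < a' -> n a <> n a'.
  move=> Xa aa' naa'; have [b' [Xb' Kb' _]] := nP a' a Xa.
  have [b [Xb Kb b'b]] := nP a b' Xb'; move: Kb; rewrite naa' => Kb.
  by case: (Kch _ _ _ _ _ Kb Kb') => -[]; rewrite leNgt ?aa'// leNgt b'b.
move=> a a'; rewrite !inE => Xa Xa' naa'.
by case: (ltgtP a a') => // /key; [move/(_ Xa)|move/(_ Xa')]; rewrite naa'.
Qed.

Lemma countryman_coinitial d (C : orderType d) (K : nat -> C -> C -> Prop)
    (X : set C) : chain_cover K ->
  exists S : set C, [/\ countable S, S `<=` X &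
    forall x, X x -> exists2 s, S s & s <= x].
Proof.
move=> [Kch Kcov].
have Kd : @chain_cover _ C^d K.
  split=> // n x y x' y' Kx Ky.
  by case: (Kch n x y x' y' Kx Ky); [right|left].
(* the reverse order has the same chains *)
exact: (@countryman_cofinal _ C^d K X Kd).
Qed.

(** * Separation by a countable set *)

(** Two points outside A are not separated exactly when they lie in the same
    complementary interval of A.  Points of A are separated even from themselves, so
    that [sep A x x] says that x is in A. *)
Definition sep d (C : orderType d) (A : set C) (x u : C) : Prop :=
  exists2 c, A c & (x <= c <= u) \/ (u <= c <= x).

Section Separation.
Context d (C : orderType d).
Implicit Types (A B : set C) (x y z u : C).

Lemma sepC A x u : sep A x u <-> sep A u x.
Proof. by split=> -[c Ac []]; exists c => //; [right|left|right|left]. Qed.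

Lemma sep_trans A x y z : sep A x z -> sep A x y \/ sep A y z.
Proof.
move=> [c Ac cP]; case: (leP y c) => yc; case: cP => /andP[h1 h2].
- by right; exists c => //; left; rewrite yc.
- by left; exists c => //; right; rewrite yc.
- by left; exists c => //; left; rewrite h1 ltW.
- by right; exists c => //; right; rewrite h1 ltW.
Qed.

Lemma nsep_sep A x y z : ~ sep A x y -> sep A y z -> sep A x z.
Proof. by move=> nxy; rewrite sepC => /(@sep_trans A z x y)[/sepC|]. Qed.

Lemma sep_mono A B x y : A `<=` B -> sep A x y -> sep B x y.
Proof. by move=> AB [c Ac cP]; exists c => //; apply: AB. Qed.

Lemma sep_id A x : A x -> sep A x x.
Proof. by exists x => //; left; rewrite lexx. Qed.

Lemma sepxx A x : sep A x x -> A x.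
Proof.
move=> [c Ac cP].
have -> : x = c by apply/eqP; rewrite eq_le andbC; case: cP => /andP[-> ->].
by [].
Qed.

Lemma sep_l A x y : A x -> sep A x y.
Proof.
move=> Ax; exists x => //.
by case: (leP x y) => h; [left|right]; rewrite lexx ?ltW.
Qed.

Lemma sep_le A x y z : sep A x y -> x <= y <= z -> sep A x z.
Proof.
move=> [c Ac cP] /andP[xy yz]; exists c => //; left; case: cP => /andP[h1 h2].
  by rewrite h1 (le_trans h2).
by rewrite (le_trans xy h1) (le_trans (le_trans h2 xy) yz).
Qed.

Lemma nsep_between B x y z :
  ~ sep B x z -> x <= y <= z -> ~ sep B x y.
Proof. by move=> nxz xyz xy; apply: nxz; apply: sep_le xyz. Qed.

Lemma sep_ge A x y z : sep A y z -> x <= y <= z -> sep A x z.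
Proof.
move=> [c Ac cP] /andP[xy yz]; exists c => //; left; case: cP => /andP[h1 h2].
  by rewrite (le_trans xy h1).
by rewrite (le_trans (le_trans xy yz) h1) (le_trans h2 yz).
Qed.

(** Whole complementary intervals lie on one side of a separated point. *)
Lemma sep_side A a x u : sep A x u -> ~ sep A a x ->
  (a <= u) = (x <= u) /\ (u <= a) = (u <= x).
Proof.
move=> xu nax.
have H1 : a <= u -> x <= u.
  move=> au; rewrite leNgt; apply/negP => ux; apply: nax.
  by apply: (@sep_ge A a u x); rewrite ?au ?ltW//; apply/sepC.
have H2 : x <= u -> a <= u.
  move=> xu'; rewrite leNgt; apply/negP => ua; apply: nax; apply/sepC.
  by apply: (@sep_le A x u a); rewrite ?xu' ?ltW.
have H3 : u <= a -> u <= x.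
  move=> ua; rewrite leNgt; apply/negP => xu'; apply: nax; apply/sepC.
  by apply: (@sep_le A x u a); rewrite ?ua ?ltW.
have H4 : u <= x -> u <= a.
  move=> ux; rewrite leNgt; apply/negP => au; apply: nax.
  by apply: (@sep_ge A a u x); rewrite ?ux ?ltW//; apply/sepC.
by split; apply/idP/idP.
Qed.

(** A Countryman line has no uncountable separable suborder.  For each a in R, some
    chain contains (a, b1) and (a, b2) with b1 < c < b2 and c in A.  If R were
    uncountable, two elements a < a' would share the chain and the point c; then
    (a, b2) and (a', b1') are incomparable, since b1' < c < b2. *)
Lemma separated_countable (K : nat -> C -> C -> Prop) A (R : set C) :
    chain_cover K -> countable A -> R `&` A = set0 ->
    (forall b b', R b -> R b' -> b <> b' -> sep A b b') ->
  countable R.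
Proof.
move=> [Kch Kcov] Ac RA Rsep; apply: contrapT => Runc; apply: (Runc).
have two a : exists nc : nat * C, A nc.2 /\ exists b1 b2, [/\ K nc.1 a b1,
    K nc.1 a b2, b1 < nc.2 & nc.2 < b2].
  have [n nP] : exists n, ~ countable (R `&` K n a).
    apply: contrapT => nn; apply: Runc.
    apply: (@sub_countable _ _ _ (\bigcup_n (R `&` K n a))).
      apply: subset_card_le => b Rb; have [n Kn] := Kcov a b.
      by exists n.
    apply: bigcup_countable => // n _; apply: contrapT => nc.
    by apply: nn; exists n.
  have [b [b' [Rb Rb' Kb Kb' bb']]] : exists b b',
      [/\ R b, R b', K n a b, K n a b' & b < b'].
    apply: contrapT => nb; apply: nP; apply/countable_injP; exists (fun=> 0%N).
    move=> b b'; rewrite !inE => -[Rb Kb] [Rb' Kb'] _.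
    case: (ltgtP b b') => // h; case: nb.
      by exists b, b'.
    by exists b', b.
  have [c Ac' cP] : sep A b b' by apply: Rsep => // E; rewrite E ltxx in bb'.
  have {cP} /andP[bc cb'] : b <= c <= b'.
    case: cP => // /andP[h1 h2].
    by have := le_lt_trans (le_trans h1 h2) bb'; rewrite ltxx.
  have nA r : R r -> c <> r.
    move=> Rr E; have : (R `&` A) r by split=> //; rewrite -E.
    by rewrite RA.
  exists (n, c); split=> //=; exists b, b'; split=> //.
    by rewrite lt_neqAle bc andbT; apply/eqP => E; apply: (nA b).
  by rewrite lt_neqAle cb' andbT; apply/eqP; apply: nA.
have {two}/choice[f fP] := two.
have /countable_injP[e einj] := countableX (countableP [set: nat]) Ac.
apply/countable_injP; exists (e \o f) => a a'; rewrite !inE => Ra Ra' /= E.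
have {E} E : f a = f a'.
  by apply: einj E; rewrite inE; split=> //=; [case: (fP a) | case: (fP a')].
have key x x' : f x = f x' -> x < x' -> False.
  move=> fxx' xx'; have [_ [b1 [b2 [_ Kb2 _ cb2]]]] := fP x.
  have [_ [b1' [b2' [Kb1' _ b1c' _]]]] := fP x'.
  move: Kb2 cb2; rewrite fxx' => Kb2 cb2.
  case: (Kch _ _ _ _ _ Kb2 Kb1') => -[h1 h2].
    by move: h2; rewrite leNgt (lt_trans b1c' cb2).
  by move: h1; rewrite leNgt xx'.
by case: (ltgtP a a') => // /key; [move/(_ E)|move/(_ (esym E))].
Qed.

(** The equivalence relation whose classes are the complementary intervals of A and
    the singletons of A. *)
Definition same A x u : Prop := x = u \/ ~ sep A x u.

Lemma same_sym A x u : same A x u -> same A u x.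
Proof. by case=> [->|h]; [left|right => /sepC]. Qed.

Lemma same_trans A x u v : same A x u -> same A u v -> same A x v.
Proof.
move=> [->//|h] [<-|h']; first by right.
by right=> /(@sep_trans A x u v)[].
Qed.

(** So a countable set has only countably many complementary intervals. *)
Lemma same_code (K : nat -> C -> C -> Prop) A :
    chain_cover K -> countable A ->
  exists k : C -> nat, forall x u, k x = k u -> same A x u.
Proof.
move=> Kc Ac; pose r x := choose (fun u => `[< same A x u >]) x.
have rP x : same A x (r x).
  by apply/asboolP/(@chooseP _ (fun u => `[< same A x u >]))/asboolP; left.
have rE x u : same A x u -> r x = r u.
  move=> xu; rewrite /r (@eq_choose _ _ (fun v => `[< same A u v >])).
    by apply: choose_id; apply/asboolP; [exact: same_sym|left].
  move=> v; apply/asboolP/asboolP => h; last exact: same_trans h.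
  by apply: same_trans h; apply: same_sym.
have Rc : countable (range r).
  apply: (@sub_countable _ _ _ (A `|` (range r `\` A))).
    apply: subset_card_le => u ru.
    by have [Au|nAu] := pselect (A u); [left|right].
  apply: countable_setU => //.
  apply: (@separated_countable K A) => //.
    by apply/seteqP; split=> // x [[_ nAx] /nAx].
  move=> b b' [[x _ <-] nAx] [[x' _ <-] nAx'] neq; apply: contrapT => ns.
  apply: neq; apply: rE; apply: same_trans (rP x) _.
  by apply: same_trans (same_sym (rP x')); right.
have /countable_injP[k kinj] := Rc.
exists (k \o r) => x u /= kxu; have E : r x = r u.
  by apply: kinj; rewrite // inE; [exists x|exists u].
by apply: same_trans (rP x) _; rewrite E; apply: same_sym.
Qed.

End Separation.

(** * Martin's axiom for finite cliques *)

Section Cliques.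
Context (T : choiceType) (ok : T -> T -> Prop).

Definition clique (p : seq T) : Prop :=
  forall s t, s \in p -> t \in p -> ok s t.

(** Martin's axiom for the finite cliques of a relation, ordered by reverse
    inclusion, with the conclusion stated for the union of the generic filter. *)
Lemma MA_cliques dW (W : orderType dW) (N : set (set T)) :
    MA_aleph1 W -> N #<= [set: W] ->
    (forall Q : set (seq T), (forall p, Q p -> clique p) -> ~ countable Q ->
       exists p q, [/\ Q p, Q q, p <> q & clique (p ++ q)]) ->
    (forall p X, clique p -> N X -> exists2 t, X t & clique (t :: p)) ->
  exists2 R : set T, (forall s t, R s -> R t -> ok s t) &
    forall X, N X -> R `&` X !=set0.
Proof.
move=> MA Ncard knaster extend.
pose U := {p : seq T | `[< clique p >]}.
pose le : rel U := fun p q => all (fun t => t \in val p) (val q).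
have leP p q : reflect {subset val q <= val p} (le p q) by apply: allP.
have lexx : reflexive le by move=> p; apply/leP.
have le_tr : transitive le.
  by move=> q p r /leP pq /leP qr; apply/leP => t /qr/pq.
pose P : preorderType (Order.Disp tt tt) := HB.pack U
  (Order.Le_isPreorder.Build (Order.Disp tt tt) U lexx le_tr).
have PE (p q : P) : (p <= q) = le p q by [].
have cl (p : P) : clique (val p) by case: p => p /= /asboolP.
have mkP p : clique p -> exists q : P, val q = p.
  by move=> cp; exists (exist _ p (asboolT cp)).
have P0 : [set: P] !=set0 by have [q _] := mkP [::] ltac:(by []); exists q.
have Pccc : ccc P.
  move=> Q Qanti; apply: contrapT => Qunc.
  have [| |p [q [[p' Qp <-] [q' Qq <-] pq cpq]]] := knaster (val @` Q).
  - by move=> _ [p _ <-].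
  - move=> Qc; apply: Qunc; apply: sub_countable Qc.
    have /inj_card_eq : {in Q &, injective (val : P -> seq T)}.
      by move=> x y _ _ /val_inj.
    by rewrite card_eq_le => /andP[].
  have [r rE] := mkP _ cpq.
  apply: (Qanti p' q') => //; first by move=> E; apply: pq; rewrite E.
  by exists r; rewrite PE; apply/leP => t; rewrite rE mem_cat => ->; rewrite ?orbT.
pose F := (fun X => [set p : P | exists2 t, t \in val p & X t]) @` N.
have [||G [_ _ Gdir] GF] := MA _ P P0 Pccc F.
- by apply: card_le_trans Ncard; exact: card_image_le.
- move=> _ [X NX <-] p; have [t Xt ct] := extend _ X (cl p) NX.
  have [q qE] := mkP _ ct; exists q.
    by rewrite PE; apply/leP => s; rewrite qE in_cons => ->; rewrite orbT.
  by exists t => //; rewrite qE mem_head.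
exists [set t | exists2 p : P, G p & t \in val p].
  move=> s t [p Gp ps] [q Gq qt]; have [r Gr [/leP rp /leP rq]] := Gdir p q Gp Gq.
  by apply: (cl r); [apply: rp|apply: rq].
move=> X NX; have [|p [Gp [t pt Xt]]] := GF [set p : P | exists2 t, t \in val p & X t].
  by exists X.
by exists t; split=> //; exists p.
Qed.

End Cliques.

(** * Filtrations of a line *)

Definition leftend d (C : orderType d) (A : set C) (x : C) : Prop :=
  ~ A x /\ forall z, z < x -> sep A z x.

Definition rightend d (C : orderType d) (A : set C) (x : C) : Prop :=
  ~ A x /\ forall z, x < z -> sep A z x.

Definition next_level dW (W : orderType dW) (E : set W) (h z : W) : Prop :=
  [/\ E h, E z, h < z & forall k, E k -> k <= h \/ z <= k].

(** [E] is the set of levels.  [fil_step] says that any two points are first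
    separated at a successor level; the levels on both sides of the splitting are
    recorded because the stage before it is the one at which a new point has to be
    placed.  The other fields are the elementarity that makes the placement
    possible: points of a level are limits of points of that level, and a level is
    coinitial and cofinal in every complementary interval of a lower one. *)
Record filtration dW (W : orderType dW) d (C : orderType d) (E : set W)
    (A : W -> set C) : Prop := Filtration {
  fil_mono : {homo A : v w / v <= w >-> v `<=` w};
  fil_step : forall x u, exists h z,
    [/\ next_level E h z, ~ sep (A h) x u & sep (A z) x u];
  fil_near_right : forall z c x, E z -> A z c -> c < x ->
    exists2 a, A z a & c < a <= x;
  fil_near_left : forall z c x, E z -> A z c -> x < c ->
    exists2 a, A z a & x <= a < c;
  fil_coinitial : forall h z x, E h -> E z -> h < z -> ~ A h x ->
    exists a, [/\ A z a, ~ sep (A h) a x & a <= x];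
  fil_cofinal : forall h z x, E h -> E z -> h < z -> ~ A h x ->
    exists a, [/\ A z a, ~ sep (A h) a x & x <= a] }.

Section Filtration.
Context dW (W : orderType dW) d (C : orderType d) (E : set W) (A : W -> set C).
Hypothesis filA : filtration E A.

Lemma nsep_mono v w x y : v <= w -> ~ sep (A w) x y -> ~ sep (A v) x y.
Proof. by move=> vw nw /(sep_mono (fil_mono filA vw)). Qed.

Lemma leftend_next h z x : E h -> E z -> h < z -> leftend (A h) x -> A z x.
Proof.
move=> Eh Ez hz [nAx xl]; have [a [Aa nax]] := fil_coinitial filA Eh Ez hz nAx.
by rewrite le_eqVlt => /orP[/eqP <-//|/xl /nax].
Qed.

Lemma rightend_next h z x : E h -> E z -> h < z -> rightend (A h) x -> A z x.
Proof.
move=> Eh Ez hz [nAx xl]; have [a [Aa nax]] := fil_cofinal filA Eh Ez hz nAx.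
by rewrite le_eqVlt => /orP[/eqP ->//|/xl /nax].
Qed.

(** Locates x with respect to finitely many points: [h] is the last level at which x
    shares a complementary interval with one of them. *)
Lemma branching (X : seq C) x : X != [::] -> exists h z x0,
  [/\ next_level E h z, x0 \in X, ~ sep (A h) x x0 &
      forall u, u \in X -> sep (A z) x u].
Proof.
move=> X0; have /choice[h /choice[z hz]] := fil_step filA x.
have [x0 x0X x0max] := seq_argmax h X0.
exists (h x0), (z x0), x0; have [nx0 nsx0 _] := hz x0; split=> // u uX.
have [[_ _ huzu nu] _ su] := hz u; apply: sep_mono su; apply: (fil_mono filA).
have [_ Ez lt _] := nx0; have [zh|//] := nu _ Ez.
by have := le_lt_trans (le_trans zh (x0max _ uX)) lt; rewrite ltxx.
Qed.

(** The interval of [x'] at level [h] has room for a point between [lo] and [hi]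
    that is separated from both at the next level and is as late as desired.  Two
    points a < b of level z are found between [lo] and [hi]; when one of the lists is
    empty this needs that the extreme element of the other is not an endpoint of the
    interval. *)
Lemma point_between (lo hi : seq C) h z x' w :
    (forall a b, a < b -> exists2 x, a < x < b & ~ A w x) ->
    next_level E h z -> lo ++ hi != [::] ->
    (forall u, u \in lo ++ hi -> ~ sep (A h) x' u) ->
    (forall u v, u \in lo -> v \in hi -> u < v /\ sep (A z) u v) ->
    (lo = [::] -> forall v, v \in hi -> ~ leftend (A h) v) ->
    (hi = [::] -> forall u, u \in lo -> ~ rightend (A h) u) ->
  exists x, [/\ ~ sep (A h) x x', ~ A w x,
    forall u, u \in lo -> u < x /\ sep (A z) u x &
    forall v, v \in hi -> x < v /\ sep (A z) x v].
Proof.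
move=> unc [Eh Ez hz _] ne inJ lohi nleft nright.
suff [a [b [Aa Ab ab na [loa bhi nb]]]] : exists a b,
    [/\ A z a, A z b, a < b, ~ sep (A h) a x' &
      [/\ forall u, u \in lo -> u <= a, forall v, v \in hi -> b <= v &
          ~ sep (A h) a b]].
  have [x /andP[ax xb] nAx] := unc _ _ ab.
  exists x; split=> //.
  - have nax : ~ sep (A h) a x by apply: (nsep_between nb); rewrite !ltW.
    by move=> /(nsep_sep nax).
  - move=> u /loa ua; split; first exact: le_lt_trans ax.
    by exists a => //; left; rewrite ua ltW.
  - move=> v /bhi bv; split; first exact: lt_le_trans bv.
    by exists b => //; left; rewrite bv ltW.
have nJ u v : u \in lo ++ hi -> v \in lo ++ hi -> ~ sep (A h) u v.
  by move=> /inJ nu /inJ nv; move=> /(nsep_sep nu) /nv.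
have [lo0|lo0] := eqVneq lo [::].
  have hi0 : hi != [::] by rewrite lo0 in ne.
  have [v vhi vmin] := seq_argmin id hi0.
  have vin : v \in lo ++ hi by rewrite mem_cat vhi orbT.
  have nAv : ~ A h v by move=> Av; apply: (inJ _ vin); apply/sepC/sep_l.
  have [t tv nt] : exists2 t, t < v & ~ sep (A h) t v.
    apply: contrapT => nt; apply: (nleft lo0 v vhi); split=> // t tv.
    by apply: contrapT => ns; apply: nt; exists t.
  have nAt : ~ A h t by move=> At; apply/nt/sep_l.
  have [a [Aa na at_]] := fil_coinitial filA Eh Ez hz nAt.
  have av := le_lt_trans at_ tv.
  have [b Ab /andP[ab bv]] := fil_near_right filA Ez Aa av.
  have nav : ~ sep (A h) a v by move=> /(@sep_trans _ _ _ a t v)[].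
  exists a, b; split=> //.
    by move=> /(@sep_trans _ _ _ a v x')[//|/sepC]; apply: inJ.
  split; [by rewrite lo0 | by move=> u /vmin; apply: le_trans bv |].
  by apply: nsep_between nav _; rewrite bv ltW.
have [hi0|hi0] := eqVneq hi [::].
  have [v vlo vmax] := seq_argmax id lo0.
  have vin : v \in lo ++ hi by rewrite mem_cat vlo.
  have nAv : ~ A h v by move=> Av; apply: (inJ _ vin); apply/sepC/sep_l.
  have [t tv nt] : exists2 t, v < t & ~ sep (A h) t v.
    apply: contrapT => nt; apply: (nright hi0 v vlo); split=> // t tv.
    by apply: contrapT => ns; apply: nt; exists t.
  have nAt : ~ A h t by move=> At; apply/nt/sep_l.
  have [b [Ab nb tb]] := fil_cofinal filA Eh Ez hz nAt.
  have vb := lt_le_trans tv tb.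
  have [a Aa /andP[va ab]] := fil_near_left filA Ez Ab vb.
  have nvb : ~ sep (A h) v b by move=> /sepC /(@sep_trans _ _ _ b t v)[].
  have nva : ~ sep (A h) v a by apply: nsep_between nvb _; rewrite va ltW.
  exists a, b; split=> //.
    by move=> /(@sep_trans _ _ _ a v x')[/sepC//|/sepC]; apply: inJ.
  split; [by move=> u /vmax h1; apply: le_trans va | by rewrite hi0 |].
  by move=> /(@sep_trans _ _ _ a v b)[/sepC|].
have [u ulo umax] := seq_argmax id lo0; have [v vhi vmin] := seq_argmin id hi0.
have uin : u \in lo ++ hi by rewrite mem_cat ulo.
have vin : v \in lo ++ hi by rewrite mem_cat vhi orbT.
have [uv [c Ac cP]] := lohi u v ulo vhi.
have {cP} /andP[uc cv] : u <= c <= v.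
  case: cP => // /andP[h1 h2].
  by have := le_lt_trans (le_trans h1 h2) uv; rewrite ltxx.
have [a [b [Aa Ab ab ua bv]]] : exists a b,
    [/\ A z a, A z b, a < b, u <= a & b <= v].
  move: cv; rewrite le_eqVlt => /orP[/eqP E'|cv].
    move: uv; rewrite -E' => /(fil_near_left filA Ez Ac)[a Aa /andP[ua ac]].
    by exists a, c; rewrite E'; split=> //; rewrite -E'.
  have [b Ab /andP[cb bv]] := fil_near_right filA Ez Ac cv.
  by exists c, b.
have nuv := nJ _ _ uin vin.
have nua : ~ sep (A h) u a.
  by apply: nsep_between nuv _; rewrite ua (le_trans (ltW ab)).
have nub : ~ sep (A h) u b.
  by apply: nsep_between nuv _; rewrite bv (le_trans ua (ltW ab)).
exists a, b; split=> //.
  by move=> /(@sep_trans _ _ _ a u x')[/sepC//|/sepC]; apply: inJ.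
split; [by move=> s /umax h1; apply: le_trans ua
       | by move=> s /vmin; apply: le_trans |].
by move=> /(@sep_trans _ _ _ a u b)[/sepC|].
Qed.

End Filtration.

(** * Admissible pairs *)

Section Admissible.
Context dW (W : orderType dW) dC (C : orderType dC) dC' (C' : orderType dC').
Context (E : set W) (A : W -> set C) (A' : W -> set C').

(** A pair (x, y) with x an end of its interval and y inside would prevent the points
    beyond y from ever being reached.  Such a restriction is imposed only at levels
    not containing y: at later ones the interval of x is collapsed to y. *)
Definition endpoints_kept (t : C * C') : Prop := forall w, E w -> ~ A' w t.2 ->
  (leftend (A w) t.1 -> leftend (A' w) t.2) /\
  (rightend (A w) t.1 -> rightend (A' w) t.2).

(** The last two conditions are asymmetric: separation in C passes to C', whereas
    separation in C' passes to C only when y and v differ, because an interval of C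
    may be collapsed to a point. *)
Definition admissible (t s : C * C') : Prop :=
  [/\ endpoints_kept t, endpoints_kept s,
      (t.1 <= s.1 -> t.2 <= s.2) /\ (s.1 <= t.1 -> s.2 <= t.2),
      forall w, E w -> sep (A w) t.1 s.1 -> sep (A' w) t.2 s.2 &
      forall w, E w -> sep (A' w) t.2 s.2 -> t.2 = s.2 \/ sep (A w) t.1 s.1].

End Admissible.

(** The values of chains to one side of a point of level v are bounded, in the other
    coordinate, by values at level u.  The case u = v is the closure used in
    [same_chain_admissible]. *)
Definition chains_over dW (W : orderType dW) dC (C : orderType dC)
    dC' (C' : orderType dC') (A : W -> set C) (A' : W -> set C')
    (K : nat -> C -> C' -> Prop) v u : Prop :=
  [/\ forall n c x y, A v c -> K n x y -> x <= c ->
        exists x1 y1, [/\ K n x1 y1, x1 <= c, A' u y1 & y <= y1],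
      forall n c x y, A' v c -> K n x y -> y <= c ->
        exists x1 y1, [/\ K n x1 y1, y1 <= c, A u x1 & x <= x1] &
      forall n c x y, A' v c -> K n x y -> c <= y ->
        exists x1 y1, [/\ K n x1 y1, c <= y1, A u x1 & x1 <= x]].

Section AdmissibleTheory.
Context dW (W : orderType dW) dC (C : orderType dC) dC' (C' : orderType dC').
Context (E : set W) (A : W -> set C) (A' : W -> set C').
Hypothesis (filA : filtration E A) (filA' : filtration E A').
Implicit Types t s r : C * C'.
Local Notation ok := (admissible E A A').

Lemma admissible_sym t s : ok t s -> ok s t.
Proof.
move=> [et es [m1 m2] s1 s2]; split=> // w Ew /sepC; first by move=> /(s1 w Ew)/sepC.
by move=> /(s2 w Ew)[->|/sepC]; [left|right].
Qed.

Lemma clique_cons t p :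
  ok t t -> (forall s, s \in p -> ok t s) -> clique ok p -> clique ok (t :: p).
Proof.
move=> tt tp cp s r; rewrite !inE => /orP[/eqP ->|sp] /orP[/eqP ->|rp] //.
- exact: tp.
- exact/admissible_sym/tp.
- exact: cp.
Qed.

Section Transfer.
Context (K : nat -> C -> C' -> Prop).
Hypothesis Kchain : forall n, chain_rel (K n).
Hypothesis Kclosed : forall w, E w -> chains_over A A' K w w.

(** A point x may be matched with a point y of lower level, never of higher
    level.  This is the separation condition of a pair with itself. *)
Definition level_le t : Prop := forall w, E w -> A w t.1 -> A' w t.2.

Lemma admissible_level t : ok t t -> level_le t.
Proof. by move=> [_ _ _ s1 _] w Ew /sep_id /(s1 w Ew)/sepxx. Qed.

(** A chain is a monotone relation.  If c at level w lies between t.1 and s.1, the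
    part of the chain to the left of c is closed off at level w, so some point of
    level w bounds the second coordinates of that part, and it falls between t.2 and
    s.2.  The same argument with the coordinates exchanged gives the converse, where
    a point c equal to t.2 has to be approached from the right instead of the left. *)
Lemma same_chain_le_admissible n t s : K n t.1 t.2 -> K n s.1 s.2 ->
  endpoints_kept E A A' t -> endpoints_kept E A A' s -> level_le t -> level_le s ->
  (t.1 = s.1 -> t.2 = s.2) ->
  t.1 <= s.1 -> t.2 <= s.2 -> ok t s.
Proof.
move=> Kt Ks et es lt_ ls fn le1 le2; split=> //.
- split=> // le3; have e1 : t.1 = s.1 by apply/eqP; rewrite eq_le le1.
  by rewrite (fn e1).
- move=> w Ew [c Ac cP].
  have {cP} /andP[tc cs] : t.1 <= c <= s.1.
    by case: cP => // /andP[h1 h2]; rewrite (le_trans le1 h1) (le_trans h2 le1).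
  have [At|nAt] := pselect (A w t.1); first by apply: sep_l; apply: lt_.
  have [As|nAs] := pselect (A w s.1).
    by apply/sepC/sep_l; apply: ls.
  have [K_up _ _] := Kclosed Ew.
  have [x1 [y1 [K1 x1c Ay1 ty1]]] := K_up _ _ _ _ Ac Kt tc.
  exists y1 => //; left; rewrite ty1 /=.
  case: (Kchain K1 Ks) => -[h1 h2] //.
  have E1 : s.1 = c by apply/eqP; rewrite eq_le cs andbT (le_trans h1).
  by rewrite E1 in nAs.
- move=> w Ew [c Ac cP].
  have {cP} /andP[tc cs] : t.2 <= c <= s.2.
    by case: cP => // /andP[h1 h2]; rewrite (le_trans le2 h1) (le_trans h2 le2).
  have [e2|ne2] := eqVneq t.2 s.2; [by left | right].
  have lt2 : t.2 < s.2 by rewrite lt_neqAle ne2.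
  have [_ K_up' K_down'] := Kclosed Ew.
  have [cs'|sc] := ltP c s.2.
    have [x1 [y1 [K1 y1c Ax1 tx1]]] := K_up' _ _ _ _ Ac Kt tc.
    exists x1 => //; left; rewrite tx1 /=.
    case: (Kchain K1 Ks) => -[h1 h2] //.
    by have := le_lt_trans (le_trans h2 y1c) cs'; rewrite ltxx.
  have [x1 [y1 [K1 cy1 Ax1 x1s]]] := K_down' _ _ _ _ Ac Ks cs.
  exists x1 => //; left; rewrite x1s andbT.
  case: (Kchain Kt K1) => -[h1 h2] //.
  by have := lt_le_trans lt2 (le_trans (le_trans sc cy1) h2); rewrite ltxx.
Qed.

Lemma same_chain_admissible n t s : K n t.1 t.2 -> K n s.1 s.2 ->
  endpoints_kept E A A' t -> endpoints_kept E A A' s -> level_le t -> level_le s ->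
  (t.1 = s.1 -> t.2 = s.2) ->
  ok t s.
Proof.
move=> Kt Ks et es lt_ ls fn; case: (Kchain Kt Ks) => -[h1 h2].
  exact: (@same_chain_le_admissible n).
by apply: admissible_sym; apply: (@same_chain_le_admissible n) => // /esym /fn.
Qed.

(** Here t and s are pairs of one condition p, and r is the pair corresponding to t
    in a condition inside level d that looks like p over level g.  If d separates
    t.1 and s.1 then so does g, and r cannot be distinguished from t as seen from s.
    Otherwise t.1 and s.1 lie in the same complementary interval at level d, which
    r.1 avoids, so s cannot be distinguished from t as seen from r; and r and t are
    in one chain. *)
Lemma admissible_transfer n g d t s r : E g -> E d -> g < d -> ok t s -> ok t t ->
    ok r r -> K n t.1 t.2 -> K n r.1 r.2 -> A d r.1 ->
    same (A g) r.1 t.1 -> same (A' g) r.2 t.2 ->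
    (A d t.1 -> A g t.1) -> (sep (A d) t.1 s.1 -> sep (A g) t.1 s.1) ->
  ok r s.
Proof.
move=> Eg Ed gd ts tt rr Kt Kr Ar same1 same2 Atd sepd.
have le_g_d := ltW gd.
have Ar' : A' d r.2 by apply: admissible_level.
have [er _ _ _ _] := rr; have [et es [m1 m2] s1 s2] := ts.
have [At|nAt] := pselect (A d t.1).
  have e1 : r.1 = t.1 by case: same1 => // -[]; apply/sepC/sep_l/Atd.
  have At' : A' g t.2 by apply: admissible_level => //; apply: Atd.
  have e2 : r.2 = t.2 by case: same2 => // -[]; apply/sepC/sep_l.
  by rewrite (surjective_pairing r) e1 e2 -surjective_pairing.
have [_ _ [n1 n2] p1 p2] : ok r t.
  apply: (@same_chain_admissible n) => //; try exact: admissible_level.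
  by move=> e1; rewrite e1 in Ar.
have le_or w v : E w -> E v -> w <= v \/ v <= w.
  by move=> _ _; case: (leP w v) => h; [left|right; apply: ltW].
have [sd|nsd] := pselect (sep (A d) t.1 s.1).
  have sg := sepd sd; have sg' := s1 g Eg sg.
  have nrt : ~ sep (A g) r.1 t.1 by case: same1 => // e1; rewrite e1 in Ar.
  have rs : sep (A g) r.1 s.1 by apply: nsep_sep nrt _.
  have rs' : sep (A' g) r.2 s.2 by case: same2 => [->//|h]; apply: nsep_sep h _.
  have [l1 l2] := sep_side sg nrt.
  have [l1' l2'] : (r.2 <= s.2) = (t.2 <= s.2) /\ (s.2 <= r.2) = (s.2 <= t.2).
    by case: same2 => [->//|h]; apply: sep_side h.
  split=> //; first by rewrite l1 l2 l1' l2'.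
  - move=> w Ew; case: (le_or w g Ew Eg) => wg srs; last first.
      by apply: sep_mono rs'; apply: fil_mono filA' _ _ wg.
    have st : sep (A w) t.1 s.1.
      by apply: nsep_sep srs => /sepC; apply: (nsep_mono filA wg).
    have := s1 w Ew st; case: same2 => [->//|h]; apply: nsep_sep.
    exact: (nsep_mono filA' wg).
  - move=> w Ew; case: (le_or w g Ew Eg) => wg srs; last first.
      by right; apply: sep_mono rs; apply: fil_mono filA _ _ wg.
    have st : sep (A' w) t.2 s.2.
      case: same2 => [<-//|h]; apply: nsep_sep srs => /sepC.
      exact: (nsep_mono filA' wg).
    case: (s2 w Ew st) => [e2|h]; last first.
      by right; apply: nsep_sep h; apply: (nsep_mono filA wg).
    left; rewrite -e2; case: same2 => // -[]; apply/sepC/sep_l.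
    by move: sg'; rewrite -e2 => /sepxx.
have [st|ns'] : t.2 = s.2 \/ ~ sep (A' d) t.2 s.2.
  have [/(s2 d Ed)[h|//]|h] := pselect (sep (A' d) t.2 s.2); by [left|right].
all: have nsd' : ~ sep (A d) s.1 t.1 by move=> /sepC.
all: have [l1 l2] := sep_side (proj1 (sepC _ _ _) (sep_l t.1 Ar)) nsd'.
- split=> //.
  + by rewrite l1 l2 -st.
  + move=> w Ew; case: (le_or w d Ew Ed) => wd srs; last first.
      by apply: sep_l; apply: (fil_mono filA' wd).
    rewrite -st; apply: p1 => //; apply/sepC; move/sepC: srs; apply: nsep_sep.
    exact: (nsep_mono filA wd).
  + move=> w Ew; case: (le_or w d Ew Ed) => wd srs; last first.
      by right; apply: sep_l; apply: (fil_mono filA wd).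
    rewrite -st in srs *; case: (p2 w Ew srs) => [|h]; [by left|right].
    apply/sepC; move/sepC: h; apply: nsep_sep.
    exact: (nsep_mono filA wd).
- have ns'' : ~ sep (A' d) s.2 t.2 by move=> /sepC.
  have [l1' l2'] := sep_side (proj1 (sepC _ _ _) (sep_l t.2 Ar')) ns''.
  split=> //.
  + by rewrite l1 l2 l1' l2'.
  + move=> w Ew; case: (le_or w d Ew Ed) => wd srs; last first.
      by apply: sep_l; apply: (fil_mono filA' wd).
    have h : sep (A' w) r.2 t.2.
      apply: p1 => //; apply/sepC; move/sepC: srs; apply: nsep_sep.
      exact: (nsep_mono filA wd).
    apply/sepC; move/sepC: h; apply: nsep_sep.
    exact: (nsep_mono filA' wd).
  + move=> w Ew; case: (le_or w d Ew Ed) => wd srs; last first.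
      by right; apply: sep_l; apply: (fil_mono filA wd).
    have h : sep (A' w) r.2 t.2.
      apply/sepC; move/sepC: srs; apply: nsep_sep.
      exact: (nsep_mono filA' wd).
    case: (p2 w Ew h) => [e2|h']; last first.
      right; apply/sepC; move/sepC: h'; apply: nsep_sep.
      exact: (nsep_mono filA wd).
    by case: ns'; apply: sep_l; rewrite -e2.
Qed.

End Transfer.

End AdmissibleTheory.

(** * Uncountable families of finite cliques *)

Section Knaster.
Context dW (W : orderType dW) dC (C : orderType dC) dC' (C' : orderType dC').
Context (E : set W) (A : W -> set C) (A' : W -> set C').
Hypothesis (omW : is_omega1 W).
Hypothesis (filA : filtration E A) (filA' : filtration E A').
Context (K : nat -> C -> C' -> Prop).
Hypothesis Kchain : forall n, chain_rel (K n).
Hypothesis K_cover : forall x y, exists n, K n x y.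
Hypothesis Kclosed : forall w, E w -> chains_over A A' K w w.
Hypothesis Acode : forall w,
  exists k : C -> nat, forall x u, k x = k u -> same (A w) x u.
Hypothesis Acode' : forall w,
  exists k : C' -> nat, forall x u, k x = k u -> same (A' w) x u.
Hypothesis Acount : forall w, countable (A w).
Hypothesis Acount' : forall w, countable (A' w).
Hypothesis reflect_level : forall F : W -> W, exists d,
  [/\ E d, exists v, v < d, forall w, w < d -> F w < d,
      forall w, w < d -> exists2 k, E k & w < k < d &
      forall x, A d x -> exists2 w, w < d & A w x].

(** The pattern of a condition over a level g records, for each of its pairs, a chain
    containing the pair and the classes of its coordinates over g.  There are
    countably many patterns over g, so a closed level d contains a member of Q with
    each pattern over each g < d that is realized in Q at all. *)
Lemma admissible_knaster (Q : set (seq (C * C'))) :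
    (forall p, Q p -> clique (admissible E A A') p) -> ~ countable Q ->
  exists p q, [/\ Q p, Q q, p <> q & clique (admissible E A A') (p ++ q)].
Proof.
move=> Qcl Qunc.
have /choice[k kP] := Acode; have /choice[k' kP'] := Acode'.
have /choice[n nP] : forall t : C * C', exists n, K n t.1 t.2.
  by move=> t; apply: K_cover.
pose tp w (t : C * C') := (n t, k w t.1, k' w t.2).
have /choice[rep repP] : forall wc : W * seq (nat * nat * nat), exists q,
    (exists2 p, Q p & map (tp wc.1) p = wc.2) ->
    Q q /\ map (tp wc.1) q = wc.2.
  move=> wc; have [[p Qp pE]|np] :=
    pselect (exists2 p, Q p & map (tp wc.1) p = wc.2).
    by exists p.
  by exists [::] => -[p Qp pE]; case: np; exists p.
have /choice[F FP] : forall w, exists v, forall c, forall t, t \in rep (w, c) ->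
    A v t.1 /\ A' v t.2.
  move=> w.
  have [|||v vP] := @omega1_uniform _ W omW _ [set: seq (nat * nat * nat)]
      (fun c v => forall t, t \in rep (w, c) -> A v t.1 /\ A' v t.2).
  - exact: countableP.
  - move=> c v u vu h t /h[h1 h2].
    by split; [apply: (fil_mono filA vu)|apply: (fil_mono filA' vu)].
  - move=> c _.
    have [|||v vP] := @omega1_uniform _ W omW _ [set t | t \in rep (w, c)]
      (fun t v => A v t.1 /\ A' v t.2).
    + exact: countable_mem.
    + move=> t v u vu [h1 h2].
      by split; [apply: (fil_mono filA vu)|apply: (fil_mono filA' vu)].
    + move=> t _; have [_ [z [_ _ /sepxx h]]] := fil_step filA t.1 t.1.
      have [_ [z' [_ _ /sepxx h']]] := fil_step filA' t.2 t.2.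
      exists (Order.max z z'); split.
        by apply: (fil_mono filA) h; rewrite le_max lexx.
      by apply: (fil_mono filA') h'; rewrite le_max lexx orbT.
    by exists v.
  by exists v => c; apply: vP.
have [d [Ed d0 Fd limd contd]] := reflect_level F.
have [p Qp [t0 t0p nt0]] : exists2 p, Q p &
    exists2 t0, t0 \in p & ~ (A d t0.1 /\ A' d t0.2).
  apply: contrapT => np; apply: Qunc.
  apply: sub_countable (countable_seqs (countableX (Acount d) (Acount' d))).
  apply: subset_card_le => p Qp t tp_ /=; apply: contrapT => nt; apply: np.
  by exists p => //; exists t.
(* d is a limit of levels, so what it separates in p is separated earlier *)
have [v vd vP] : exists2 v, v < d & forall t, t \in p -> forall s, s \in p ->
    sep (A d) t.1 s.1 -> sep (A v) t.1 s.1.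
  apply: seq_reflect => //.
    move=> t v w vw h s sp /(h s sp); apply: sep_mono; exact: (fil_mono filA vw).
  move=> t _; apply: seq_reflect => //.
    move=> s v w vw h /h; apply: sep_mono; exact: (fil_mono filA vw).
  move=> s _; have [[c Ac cP]|ns] := pselect (sep (A d) t.1 s.1).
    by have [w wd Aw] := contd c Ac; exists w => // _; exists c.
  by have [v vd] := d0; exists v.
have [g Eg /andP[vg gd]] := limd v vd.
have {vP} gP t s : t \in p -> s \in p -> sep (A d) t.1 s.1 -> sep (A g) t.1 s.1.
  move=> tp_ sp /(vP t tp_ s sp); apply: sep_mono; apply: (fil_mono filA).
  exact: ltW.
have [|Qq qE] := repP (g, map (tp g) p); first by exists p.
set q := rep _ in Qq qE.
have qd t : t \in q -> A d t.1 /\ A' d t.2.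
  move=> /FP[h1 h2]; split; [apply: (fil_mono filA) h1|apply: (fil_mono filA') h2].
    exact/ltW/Fd.
  exact/ltW/Fd.
have cross r s : r \in q -> s \in p -> admissible E A A' r s.
  move=> rq sp; have szE : size q = size p by rewrite -(size_map (tp g)) qE size_map.
  pose i := index r q; have iq : (i < size q)%N by rewrite index_mem.
  have ip : (i < size p)%N by rewrite -szE.
  pose t := nth r p i.
  have tp_ : t \in p by apply: mem_nth.
  have [nE kE kE'] : [/\ n r = n t, k g r.1 = k g t.1 & k' g r.2 = k' g t.2].
    have : nth (tp g r) (map (tp g) q) i = nth (tp g r) (map (tp g) p) i.
      by rewrite qE.
    by rewrite !(nth_map r)// nth_index// => -[-> -> ->].
  have [Ar _] := qd r rq.
  apply: (@admissible_transfer _ W _ C _ C' E A A' filA filA' K Kchain Kclosed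
    (n r) g d t) => //.
  - exact: (Qcl p Qp).
  - exact: (Qcl p Qp).
  - exact: (Qcl q Qq).
  - by rewrite nE.
  - exact: kP.
  - exact: kP'.
  - by move=> /sep_id /(gP t t tp_ tp_)/sepxx.
  - exact: gP.
exists q, p; split=> //; first by move=> qp; apply: nt0; apply: qd; rewrite qp.
move=> r s; rewrite !mem_cat => /orP[rq|rp] /orP[sq|sp].
- exact: (Qcl q Qq).
- exact: cross.
- exact/admissible_sym/cross.
- exact: (Qcl p Qp).
Qed.

End Knaster.

(** * Extending a finite clique *)

Section Extension.
Context dW (W : orderType dW) dC (C : orderType dC) dC' (C' : orderType dC').
Context (E : set W) (A : W -> set C) (A' : W -> set C').
Hypothesis (filA : filtration E A) (filA' : filtration E A').
Hypothesis A_codense : forall w a b, a < b -> exists2 x, a < x < b & ~ A w x.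
Hypothesis leftE : forall w, E w -> (exists x, leftend (A w) x) ->
  forall y, ~ A' w y -> exists2 y0, leftend (A' w) y0 & ~ sep (A' w) y0 y.
Hypothesis rightE : forall w, E w -> (exists x, rightend (A w) x) ->
  forall y, ~ A' w y -> exists2 y0, rightend (A' w) y0 & ~ sep (A' w) y0 y.
Local Notation ok := (admissible E A A').
Implicit Types (t s : C * C') (p : seq (C * C')).

Lemma admissible_self x y : endpoints_kept E A A' (x, y) ->
  (forall w, E w -> A w x -> A' w y) -> ok (x, y) (x, y).
Proof.
move=> en lv; split=> //=; last by left.
by move=> w Ew /sepxx /(lv w Ew)/sep_id.
Qed.

(** When x appears later than y, the endpoint condition is vacuous: an endpoint of a
    complementary interval belongs to every later level. *)
Lemma high_level x y w : E w -> A' w y -> ~ A w x ->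
  endpoints_kept E A A' (x, y) /\ (forall v, E v -> A v x -> A' v y).
Proof.
move=> Ew Ay nAx; split; last first.
  move=> v Ev Ax; apply: (fil_mono filA') Ay; rewrite leNgt; apply/negP => vw.
  by apply: nAx; apply: (fil_mono filA (ltW vw)).
move=> v Ev /= nAy; have vw : v < w.
  by rewrite ltNge; apply/negP => wv; apply: nAy; apply: (fil_mono filA' wv).
by split=> [/(leftend_next filA Ev Ew vw)|/(rightend_next filA Ev Ew vw)].
Qed.

(** Let h be the last level at which y shares an interval with the range of p.  By the
    separation conditions, the pairs of p in that interval are exactly those in a
    single interval of C at level h, and the new x is placed there, between the
    points corresponding to the neighbours of y.  The neighbours are not endpoints of
    the interval on the side of x, since otherwise [endpoints_kept] would make their
    images endpoints, with y beyond them. *)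
Lemma extend_ran p y : clique ok p -> p != [::] ->
  exists x, clique ok ((x, y) :: p).
Proof.
move=> cp p0.
have [[x xyp]|ynew] := pselect (exists x, (x, y) \in p).
  by exists x; apply: clique_cons => // [|s sp]; apply: cp.
have [|h [z [_ [[Eh Ez hz hzE] /mapP[[x' y'] t'p ->] nh sz]]]] :=
  @branching _ W _ C' E A' filA' (map snd p) y; first by case: (p) p0.
have {}sz s : s \in p -> sep (A' z) y s.2 by move=> sp; apply: sz; apply: map_f.
rewrite /= in nh.
pose lo := [seq s.1 | s <- p & `[< ~ sep (A' h) y s.2 >] && (s.2 < y)].
pose hi := [seq s.1 | s <- p & `[< ~ sep (A' h) y s.2 >] && (y < s.2)].
have loP u : u \in lo -> exists v, [/\ (u, v) \in p, ~ sep (A' h) y v & v < y].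
  by move=> /mapP[[a b]]; rewrite mem_filter => /andP[/andP[/asboolP h1 h2] h3] ->;
    exists b.
have hiP u : u \in hi -> exists v, [/\ (u, v) \in p, ~ sep (A' h) y v & y < v].
  by move=> /mapP[[a b]]; rewrite mem_filter => /andP[/andP[/asboolP h1 h2] h3] ->;
    exists b.
have inlo s : s \in p -> ~ sep (A' h) y s.2 -> s.2 < y -> s.1 \in lo.
  move=> sp ns lt_; apply: map_f; rewrite mem_filter sp andbT lt_ andbT.
  exact/asboolP.
have inhi s : s \in p -> ~ sep (A' h) y s.2 -> y < s.2 -> s.1 \in hi.
  move=> sp ns lt_; apply: map_f; rewrite mem_filter sp andbT lt_ andbT.
  exact/asboolP.
have ney s : s \in p -> s.2 != y.
  by case: s => a b sp; apply/eqP => /= e; apply: ynew; exists a; rewrite -e.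
have nAy s : ~ sep (A' h) y s.2 -> ~ A' h s.2 by move=> ns As; apply/ns/sepC/sep_l.
have inJ u v : (u, v) \in p -> ~ sep (A' h) y v -> ~ sep (A h) x' u.
  move=> up nyv s; have [_ _ _ s1 _] := cp _ _ t'p up.
  by apply: nyv; apply: (nsep_sep nh); apply: (s1 h Eh s).
have [w0 Ew0 Aw0y] : exists2 w, E w & A' w y.
  by have [_ [w [[_ Ew _ _] _ /sepxx]]] := fil_step filA' y y; exists w.
have [||||||| x [nxx' nAx xlo xhi]] := @point_between _ W _ C E A filA lo hi h z x' w0.
- exact: A_codense.
- by [].
- have : x' \in lo ++ hi.
    rewrite mem_cat; have := ney _ t'p; rewrite neq_lt => /orP[lt_|lt_].
      by rewrite (inlo _ t'p).
    by rewrite (inhi _ t'p) // orbT.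
  by case: (lo ++ hi).
- by move=> u; rewrite mem_cat => /orP[/loP|/hiP] [v [up nv _]]; apply: inJ up nv.
- move=> u u' /loP[v [up nv vy]] /hiP[v' [up' nv' yv']].
  have vv' := lt_trans vy yv'; have [_ _ [m1 m2] s1 s2] := cp _ _ up up'.
  split; first by rewrite ltNge; apply/negP => /m2 /=; rewrite leNgt vv'.
  have [|/= e|//] := s2 z Ez; last by rewrite e ltxx in vv'.
  have /sepC := sz _ up => /= /sep_le; apply; by rewrite !ltW.
- move=> _ u /hiP[v [up nv yv]] lu; have [en _ _ _ _] := cp _ _ up up.
  by have [/(_ lu)[_ /(_ y yv)/nv]] := en h Eh (nAy (u, v) nv).
- move=> _ u /loP[v [up nv yv]] lu; have [en _ _ _ _] := cp _ _ up up.
  by have [_ /(_ lu)[_ /(_ y yv)/nv]] := en h Eh (nAy (u, v) nv).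
have [en lv] := high_level Ew0 Aw0y nAx.
exists x; apply: clique_cons => //; first exact: admissible_self.
move=> [u v] sp; have [_ es _ _ _] := cp _ _ sp sp.
have [_ _ [m1 m2] s1 s2] := cp _ _ t'p sp.
have le_or k : E k -> k <= h \/ z <= k by apply: hzE.
have [nv|sv] := pselect (~ sep (A' h) y v).
  have nxu : ~ sep (A h) x u.
    have nx'x : ~ sep (A h) x' x by move=> /sepC.
    by move=> /(nsep_sep nx'x); apply: inJ sp nv.
  split=> //=.
  - have := ney _ sp; rewrite neq_lt => /orP[] /= lt_.
      have [ux _] := xlo u (inlo _ sp nv lt_).
      by rewrite (ltW lt_); split=> // le_; have := lt_le_trans ux le_; rewrite ltxx.
    have [xu _] := xhi u (inhi _ sp nv lt_).
    by rewrite (ltW lt_); split=> // le_; have := lt_le_trans xu le_; rewrite ltxx.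
  - move=> k Ek; case: (le_or k Ek) => hk s; last first.
      by apply: sep_mono (sz _ sp); apply: (fil_mono filA' hk).
    by case: (nsep_mono filA hk nxu).
  - move=> k Ek; case: (le_or k Ek) => hk s; first by case: (nsep_mono filA' hk nv).
    right; have := ney _ sp; rewrite neq_lt => /orP[] /= lt_.
      have [_ /sepC h1] := xlo u (inlo _ sp nv lt_).
      by apply: sep_mono h1; apply: (fil_mono filA hk).
    have [_ h1] := xhi u (inhi _ sp nv lt_).
    by apply: sep_mono h1; apply: (fil_mono filA hk).
have {}sv : sep (A' h) y v by apply: contrapT.
have sy'v : sep (A' h) y' v by apply: nsep_sep sv => /sepC.
have ney'v : y' <> v by move=> e; apply: nh; rewrite e.
have sx'u : sep (A h) x' u by case: (s2 h Eh sy'v).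
have sxu : sep (A h) x u by apply: nsep_sep sx'u.
have [l1 l2] := sep_side sx'u nxx'; have [l1' l2'] := sep_side sy'v nh.
split=> //=.
- by rewrite l1 l2 l1' l2'.
- move=> k Ek s; have [kh|hk] := leP k h; last first.
    by apply: sep_mono sv; apply: (fil_mono filA' (ltW hk)).
  apply: (nsep_sep (nsep_mono filA' kh nh)); apply: (s1 k Ek).
  apply: nsep_sep s => /sepC; exact: (nsep_mono filA kh nxx').
- move=> k Ek s; right; have [kh|hk] := leP k h; last first.
    by apply: sep_mono sxu; apply: (fil_mono filA (ltW hk)).
  apply: (nsep_sep (nsep_mono filA kh nxx')).
  case: (s2 k Ek) => //=; apply: nsep_sep s => /sepC.
  exact: (nsep_mono filA' kh nh).
Qed.

(** Let h be the last level at which x shares an interval with the domain of p.  If p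
    sends a point of that interval to a point y' already present at level h, then it
    must collapse the whole interval to y', and x is sent to y' as well.  Otherwise p
    sends it into one interval of C', and any point there that appears at the next
    level, and that lies weakly between the images of the neighbours of x, will do,
    except that an endpoint must be sent to an endpoint.  Landing at the next level
    is what makes the separation conditions automatic. *)
Lemma extend_dom p x : clique ok p -> p != [::] ->
  exists y, clique ok ((x, y) :: p).
Proof.
move=> cp p0.
have [[y xyp]|xnew] := pselect (exists y, (x, y) \in p).
  by exists y; apply: clique_cons => // [|s sp]; apply: cp.
have [|h [z [_ [[Eh Ez hz hzE] /mapP[[x' y'] t'p ->] nh sz]]]] :=
  @branching _ W _ C E A filA (map fst p) x; first by case: (p) p0.
have {}sz s : s \in p -> sep (A z) x s.1 by move=> sp; apply: sz; apply: map_f.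
rewrite /= in nh.
have le_or k : E k -> k <= h \/ z <= k by apply: hzE.
have nAx : ~ A h x by move=> Ax; apply/nh/sep_l.
have early v : E v -> A v x -> h < v.
  by move=> Ev Ax; rewrite ltNge; apply/negP => /(fil_mono filA)/(_ _ Ax).
(* if y' has appeared by level h, the whole interval of x goes to y' *)
have [Ay'|nAy'] := pselect (A' h y').
  have en : endpoints_kept E A A' (x, y').
    move=> v Ev /= nAv; have vh : v < h.
      by rewrite ltNge; apply/negP => /(fil_mono filA')/(_ _ Ay').
    by split=> [/(leftend_next filA Ev Eh vh)|/(rightend_next filA Ev Eh vh)].
  exists y'; apply: clique_cons => //.
    apply: admissible_self => // v Ev /(early v Ev) hv.
    exact: (fil_mono filA' (ltW hv)).
  move=> [u v] sp; have [_ es _ _ _] := cp _ _ sp sp.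
  have [_ _ [m1 m2] s1 s2] := cp _ _ t'p sp.
  have [sx'u|nx'u] := pselect (sep (A h) x' u); last first.
    have e : y' = v by case: (s2 h Eh (sep_l _ Ay')).
    subst v.
    split=> //=; last by left.
    move=> k Ek; case: (le_or k Ek) => hk s; last first.
      by apply: sep_l; apply: (fil_mono filA') Ay'; apply: le_trans hk; apply: ltW.
    case: nx'u; apply: (sep_mono (fil_mono filA hk)).
    apply: nsep_sep s => /sepC; exact: (nsep_mono filA hk nh).
  have [l1 l2] := sep_side sx'u nh.
  split=> //=.
  - by rewrite l1 l2.
  - move=> k Ek s; have [kh|hk] := leP k h; last first.
      by apply: sep_l; apply: (fil_mono filA' (ltW hk)).
    apply: (s1 k Ek); apply: nsep_sep s => /sepC; exact: (nsep_mono filA kh nh).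
  - move=> k Ek s; case: (s2 k Ek s) => [/= e|s']; [by left|right].
    case: (le_or k Ek) => hk; last first.
      by apply: sep_mono (sz _ sp); apply: (fil_mono filA hk).
    by apply: nsep_sep s'; apply: (nsep_mono filA hk nh).
pose lo := [seq s <- p | `[< ~ sep (A h) x s.1 >] && (s.1 < x)].
pose hi := [seq s <- p | `[< ~ sep (A h) x s.1 >] && (x < s.1)].
have loP s : s \in lo -> [/\ s \in p, ~ sep (A h) x s.1 & s.1 < x].
  by rewrite mem_filter => /andP[/andP[/asboolP h1 h2] h3].
have hiP s : s \in hi -> [/\ s \in p, ~ sep (A h) x s.1 & x < s.1].
  by rewrite mem_filter => /andP[/andP[/asboolP h1 h2] h3].
have inlo s : s \in p -> ~ sep (A h) x s.1 -> s.1 < x -> s \in lo.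
  by move=> sp ns lt_; rewrite mem_filter sp lt_ !andbT; apply/asboolP.
have inhi s : s \in p -> ~ sep (A h) x s.1 -> x < s.1 -> s \in hi.
  by move=> sp ns lt_; rewrite mem_filter sp lt_ !andbT; apply/asboolP.
have nex s : s \in p -> s.1 != x.
  by case: s => a b sp; apply/eqP => /= e; apply: xnew; exists b; rewrite -e.
have inI s : s \in p -> ~ sep (A h) x s.1 -> ~ sep (A' h) y' s.2.
  move=> sp nxs; have [_ _ _ _ s2] := cp _ _ t'p sp => sy.
  case: (s2 h Eh sy) => [/= e|/= s'].
    by apply: nAy'; apply: sepxx; rewrite -e in sy.
  by apply: nxs; apply: (nsep_sep nh).
have nAs s : ~ sep (A' h) y' s.2 -> ~ A' h s.2 by move=> ns As; apply/ns/sepC/sep_l.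
have [y [Azy nyy' ylo yhi [yl yr]]] : exists y, [/\ A' z y, ~ sep (A' h) y y',
    forall s, s \in lo -> s.2 <= y, forall s, s \in hi -> y <= s.2 &
    (leftend (A h) x -> leftend (A' h) y) /\
    (rightend (A h) x -> rightend (A' h) y)].
  have notL s : s \in lo -> ~ leftend (A h) x.
    by move=> /loP[_ ns lt_] [_ /(_ _ lt_)/sepC].
  have notR s : s \in hi -> ~ rightend (A h) x.
    by move=> /hiP[_ ns lt_] [_ /(_ _ lt_)/sepC].
  have [lo0|lo0] := eqVneq lo [::].
    have hi0 : hi != [::].
      have := nex _ t'p; rewrite neq_lt => /orP[lt_|lt_].
        by have := inlo _ t'p nh lt_; rewrite lo0.
      by have := inhi _ t'p nh lt_; case: (hi).
    have [s shi smin] := seq_argmin fst hi0; have [sp ns xs] := hiP _ shi.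
    have nsy := inI _ sp ns; have nA := nAs _ nsy.
    have smin2 r : r \in hi -> s.2 <= r.2.
      move=> rhi; have [rp _ _] := hiP _ rhi.
      by have [_ _ [m1 _] _ _] := cp _ _ sp rp; apply/m1/smin.
    have [y [Azy nys ys yl]] : exists y, [/\ A' z y, ~ sep (A' h) y s.2, y <= s.2 &
        leftend (A h) x -> leftend (A' h) y].
      have [lx|nlx] := pselect (leftend (A h) x).
        have [|y ly ny] := leftE Eh _ nA; first by exists x.
        exists y; split=> //; first exact: (leftend_next filA' Eh Ez hz ly).
        rewrite leNgt; apply/negP => sy; case: (ly) => _ /(_ _ sy) /sepC //.
      by have [y [h1 h2 h3]] := fil_coinitial filA' Eh Ez hz nA; exists y.
    exists y; split=> //; last by split=> //; move/(notR _ shi).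
    + by move=> /(@sep_trans _ _ _ y s.2 y')[|/sepC].
    + by move=> r; rewrite lo0.
    + by move=> r /smin2; apply: le_trans.
  have [hi0|hi0] := eqVneq hi [::].
    have [s slo smax] := seq_argmax fst lo0; have [sp ns xs] := loP _ slo.
    have nsy := inI _ sp ns; have nA := nAs _ nsy.
    have smax2 r : r \in lo -> r.2 <= s.2.
      move=> rlo; have [rp _ _] := loP _ rlo.
      by have [_ _ [_ m2] _ _] := cp _ _ sp rp; apply/m2/smax.
    have [y [Azy nys ys yr]] : exists y, [/\ A' z y, ~ sep (A' h) y s.2, s.2 <= y &
        rightend (A h) x -> rightend (A' h) y].
      have [lx|nlx] := pselect (rightend (A h) x).
        have [|y ly ny] := rightE Eh _ nA; first by exists x.
        exists y; split=> //; first exact: (rightend_next filA' Eh Ez hz ly).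
        rewrite leNgt; apply/negP => sy; case: (ly) => _ /(_ _ sy) /sepC //.
      by have [y [h1 h2 h3]] := fil_cofinal filA' Eh Ez hz nA; exists y.
    exists y; split=> //; last by split=> //; move/(notL _ slo).
    + by move=> /(@sep_trans _ _ _ y s.2 y')[|/sepC].
    + by move=> r /smax2 rs; apply: le_trans ys.
    + by move=> r; rewrite hi0.
  have [s slo smax] := seq_argmax fst lo0; have [sp ns sx] := loP _ slo.
  have [r rhi rmin] := seq_argmin fst hi0; have [rp nr xr] := hiP _ rhi.
  have sr := lt_trans sx xr; have [_ _ [m1 _] s1 _] := cp _ _ sp rp.
  have le2 := m1 (ltW sr).
  have [|c Ac cP] := s1 z Ez.
    by have /sepC h1 := sz _ sp; apply: (sep_le h1); rewrite !ltW.
  have {cP} /andP[sc cr] : s.2 <= c <= r.2.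
    by case: cP => // /andP[h1 h2]; rewrite (le_trans le2 h1) (le_trans h2 le2).
  exists c; split=> //.
  - have nsr : ~ sep (A' h) s.2 r.2.
      by move=> /(nsep_sep (inI _ sp ns)); apply: inI.
    have nsc : ~ sep (A' h) s.2 c by apply: (nsep_between nsr); rewrite sc.
    by move=> /sepC /(@sep_trans _ _ _ y' s.2 c)[]//; apply: inI.
  - move=> q qlo; have [qp _ _] := loP _ qlo; apply: le_trans sc.
    by have [_ _ [_ m2] _ _] := cp _ _ sp qp; apply/m2/smax.
  - move=> q qhi; have [qp _ _] := hiP _ qhi; apply: (le_trans cr).
    by have [_ _ [m _] _ _] := cp _ _ rp qp; apply/m/rmin.
  - by split=> [/(notL _ slo)|/(notR _ rhi)].
have en : endpoints_kept E A A' (x, y).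
  move=> v Ev /= nAv; have [vh|zv] := le_or v Ev; last first.
    by case: nAv; apply: (fil_mono filA' zv).
  move: vh; rewrite le_eqVlt => /orP[/eqP -> //|vh].
  by split=> [/(leftend_next filA Ev Eh vh)|/(rightend_next filA Ev Eh vh)].
have lv v : E v -> A v x -> A' v y.
  move=> Ev Ax; have [vh|zv] := le_or v Ev; last exact: (fil_mono filA' zv).
  by have := early v Ev Ax; rewrite ltNge vh.
exists y; apply: clique_cons => //; first exact: admissible_self.
move=> [u v] sp; have [_ es _ _ _] := cp _ _ sp sp.
have [_ _ [m1 m2] s1 s2] := cp _ _ t'p sp.
have [sxu|nxu] := pselect (sep (A h) x u); last first.
  have nyv : ~ sep (A' h) y v.
    by apply: contra_not (inI _ sp nxu); apply: nsep_sep => /sepC.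
  have sxu : sep (A z) x u := sz _ sp.
  split=> //=.
  - have := nex _ sp; rewrite neq_lt => /orP[] /= lt_.
      have /= h1 := ylo _ (inlo _ sp nxu lt_).
      by split=> // le_; have := lt_le_trans lt_ le_; rewrite ltxx.
    have /= h1 := yhi _ (inhi _ sp nxu lt_).
    by split=> // le_; have := lt_le_trans lt_ le_; rewrite ltxx.
  - move=> k Ek; case: (le_or k Ek) => hk s; first by case: (nsep_mono filA hk nxu).
    by apply: sep_l; apply: (fil_mono filA' hk).
  - move=> k Ek; case: (le_or k Ek) => hk s; first by case: (nsep_mono filA' hk nyv).
    by right; apply: sep_mono sxu; apply: (fil_mono filA hk).
have sx'u : sep (A h) x' u by apply: nsep_sep sxu => /sepC.
have sy'v : sep (A' h) y' v by apply: (s1 h Eh).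
have syv : sep (A' h) y v by apply: nsep_sep sy'v.
have [l1 l2] := sep_side sx'u nh; have [l1' l2'] := sep_side sy'v nyy'.
split=> //=.
- by rewrite l1 l2 l1' l2'.
- move=> k Ek s; have [kh|hk] := leP k h; last first.
    by apply: sep_mono syv; apply: (fil_mono filA' (ltW hk)).
  apply: (nsep_sep (nsep_mono filA' kh nyy')); apply: (s1 k Ek).
  apply: nsep_sep s => /sepC; exact: (nsep_mono filA kh nh).
- move=> k Ek s; right; have [kh|hk] := leP k h; last first.
    by apply: sep_mono sxu; apply: (fil_mono filA (ltW hk)).
  apply: (nsep_sep (nsep_mono filA kh nh)).
  case: (s2 k Ek) => //=.
    apply: nsep_sep s => /sepC; exact: (nsep_mono filA' kh nyy').
  by move=> e; case: nAy'; move: sy'v; rewrite -e => /sepxx.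
Qed.

End Extension.

(** * Endpoints of complementary intervals *)

Lemma complementary_interval_nsep d (C : orderType d) (B : set C) x :
  ~ B x -> complementary_interval B [set z | ~ sep B z x].
Proof.
move=> nBx; split.
- split; first by exists x => /= /sepxx.
  move=> a b c /= na nb acb.
  have nab : ~ sep B a b by move=> /(@sep_trans _ _ _ a x b)[|/sepC].
  have nac := nsep_between nab acb.
  by move=> /(@sep_trans _ _ _ c a x)[/sepC|].
- apply/seteqP; split=> // z [/= nz Bz]; apply: nz; exact: sep_l.
- move=> J [_ Jconv] JB IJ; apply/seteqP; split=> // j Jj /= [c Bc cP].
  have Jx : J x by apply: IJ => /= /sepxx.
  have Jc : J c by case: cP; apply: Jconv.
  by have : (J `&` B) c by []; rewrite JB.
Qed.

(** The hypothesis is the one made on the levels of a club; the conclusion is what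
    extending the domain by a left endpoint requires. *)
Lemma endpoint_transfer d (C : orderType d) d' (C' : orderType d')
    (B : set C) (B' : set C') :
  ((exists2 I, complementary_interval B I & has_left_endpoint I) ->
   forall I, complementary_interval B' I -> has_left_endpoint I) ->
  (exists x, leftend B x) ->
  forall y, ~ B' y -> exists2 y0, leftend B' y0 & ~ sep B' y0 y.
Proof.
move=> H [x [nBx lx]] y nBy.
have [|y0 [/= ny0 lby0]] := H _ _ (complementary_interval_nsep nBy).
  exists [set z | ~ sep B z x]; first exact: complementary_interval_nsep.
  exists x; split=> /=; first by move/sepxx.
  by move=> z /= nz; rewrite leNgt; apply/negP => /lx.
exists y0 => //; split; first by move=> B0; apply/ny0/sep_l.
move=> z zy0; apply: contrapT => nz.
have /lby0 : ~ sep B' z y by move=> /(@sep_trans _ _ _ z y0 y)[].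
by rewrite leNgt zy0.
Qed.

Lemma endpoint_transfer_right d (C : orderType d) d' (C' : orderType d')
    (B : set C) (B' : set C') :
  ((exists2 I, complementary_interval B I & has_right_endpoint I) ->
   forall I, complementary_interval B' I -> has_right_endpoint I) ->
  (exists x, rightend B x) ->
  forall y, ~ B' y -> exists2 y0, rightend B' y0 & ~ sep B' y0 y.
Proof.
move=> H [x [nBx lx]] y nBy.
have [|y0 [/= ny0 lby0]] := H _ _ (complementary_interval_nsep nBy).
  exists [set z | ~ sep B z x]; first exact: complementary_interval_nsep.
  exists x; split=> /=; first by move/sepxx.
  by move=> z /= nz; rewrite leNgt; apply/negP => /lx.
exists y0 => //; split; first by move=> B0; apply/ny0/sep_l.
move=> z zy0; apply: contrapT => nz.
have /lby0 : ~ sep B' z y by move=> /(@sep_trans _ _ _ z y0 y)[].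
by rewrite leNgt zy0.
Qed.

(** * Closed levels *)

(** The first element is added to the closure points so that, with decompositions
    starting from the empty set, there is a level at which nothing is separated. *)
Definition levels dW (W : orderType dW) (F : W -> W) : set W :=
  [set w | closed_below F w \/ forall v, w <= v].

Section Levels.
Context dW (W : orderType dW) (omW : is_omega1 W).

(** A decomposition may be assumed to start with the empty set: only its value at
    the least index changes, and that index is not a limit. *)
Definition trim d (C : orderType d) (D : W -> set C) (w : W) : set C :=
  [set x | D w x /\ exists v, v < w].

Lemma trim_limit d (C : orderType d) (D : W -> set C) w :
  is_limit w -> trim D w = D w.
Proof. by move=> [wv _]; apply/seteqP; split=> x; [case|]. Qed.

Lemma trim_min d (C : orderType d) (D : W -> set C) w x :
  (forall v, w <= v) -> ~ trim D w x.
Proof. by move=> wmin [_ [v]]; rewrite ltNge wmin. Qed.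

Lemma trim_decomposition d (C : orderType d) (D : W -> set C) :
  is_decomposition D -> is_decomposition (trim D).
Proof.
move=> [Dc Dmon Dcov Dlim]; split.
- move=> w; apply: (sub_countable _ (Dc w)); apply: subset_card_le.
  by move=> x [].
- move=> v w vw x [Dx [u uv]]; split; first exact: Dmon Dx.
  by exists u; apply: lt_le_trans vw.
- apply/seteqP; split=> // x _.
  have : (\bigcup_w D w) x by rewrite Dcov.
  move=> [w _ Dwx]; have [v wv] := omega1_above omW w.
  by exists v => //; split; [apply: Dmon Dwx; apply: ltW|exists w].
- move=> w wl; rewrite trim_limit// Dlim//; apply/seteqP; split=> x [v /= vw].
    move=> Dx; have [_ /(_ v vw)[u vu uw]] := wl; exists u => //.
    split; last by exists v.
    apply: Dmon Dx; exact: ltW.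
  by case=> Dx _; exists v.
Qed.

Lemma levels_unbounded F (w : W) : exists2 v, w < v & levels F v.
Proof. by have [v wv cv] := closed_below_exists omW F w; exists v => //; left. Qed.

Section Line.
Context d (C : orderType d) (K : nat -> C -> C -> Prop) (A : W -> set C).
Hypothesis (coverK : chain_cover K) (decA : is_decomposition A).

Lemma dec_cover x : exists w, A w x.
Proof.
case: decA => _ _ Acov _.
by have : (\bigcup_w A w) x; [rewrite Acov|case=> w _; exists w].
Qed.

Lemma countable_bounded (S : set C) : countable S -> exists w, S `<=` A w.
Proof.
case: decA => _ Amon _ _ Sc.
apply: (omega1_uniform omW (P := fun x w => A w x) Sc).
  by move=> x v w vw; apply: Amon.
by move=> x _; apply: dec_cover.
Qed.

Lemma bounded_cofinal (X : set C) : exists w, forall x, X x ->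
  exists s, [/\ X s, A w s & x <= s].
Proof.
have [S [Sc SX Sx]] := countryman_cofinal X coverK.
have [w Sw] := countable_bounded Sc; exists w => x /Sx[s Ss xs].
by exists s; split=> //; [exact: SX|exact: Sw].
Qed.

Lemma bounded_coinitial (X : set C) : exists w, forall x, X x ->
  exists s, [/\ X s, A w s & s <= x].
Proof.
have [S [Sc SX Sx]] := countryman_coinitial X coverK.
have [w Sw] := countable_bounded Sc; exists w => x /Sx[s Ss xs].
by exists s; split=> //; [exact: SX|exact: Sw].
Qed.

(** Everything that [filtration] demands of a level u above v. *)
Definition dense_over v u : Prop :=
  [/\ forall c x, A v c -> c < x -> exists2 a, A u a & c < a <= x,
      forall c x, A v c -> x < c -> exists2 a, A u a & x <= a < c,
      forall x, ~ A v x -> exists a, [/\ A u a, ~ sep (A v) a x & a <= x] &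
      forall x, ~ A v x -> exists a, [/\ A u a, ~ sep (A v) a x & x <= a]].

Lemma dense_over_mono v u w : u <= w -> dense_over v u -> dense_over v w.
Proof.
have [_ Amon _ _] := decA; move=> uw [h1 h2 h3 h4]; split.
- by move=> c x Ac /(h1 c x Ac)[a Aa ax]; exists a => //; apply: Amon Aa.
- by move=> c x Ac /(h2 c x Ac)[a Aa ax]; exists a => //; apply: Amon Aa.
- by move=> x /h3[a [Aa ns ax]]; exists a; split=> //; apply: Amon Aa.
- by move=> x /h4[a [Aa ns ax]]; exists a; split=> //; apply: Amon Aa.
Qed.

Lemma dense_over_exists v : exists w, dense_over v w.
Proof.
have [Ac Amon _ _] := decA.
have [w1 w1P] : exists w, forall c, A v c -> forall x, c < x ->
    exists2 a, A w a & c < a <= x.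
  apply: (omega1_uniform omW (Ac v)).
    by move=> c w u wu h x /h[a Aa ax]; exists a => //; apply: Amon Aa.
  move=> c Avc; have [w wP] := bounded_coinitial [set x | c < x].
  by exists w => x /wP[a [/= ca Aa ax]]; exists a; rewrite // ca.
have [w2 w2P] : exists w, forall c, A v c -> forall x, x < c ->
    exists2 a, A w a & x <= a < c.
  apply: (omega1_uniform omW (Ac v)).
    by move=> c w u wu h x /h[a Aa ax]; exists a => //; apply: Amon Aa.
  move=> c Avc; have [w wP] := bounded_cofinal [set x | x < c].
  by exists w => x /wP[a [/= ca Aa ax]]; exists a; rewrite // ca ax.
have [k kP] := same_code coverK (Ac v).
have class x0 x : ~ A v x -> k x0 = k x -> ~ sep (A v) x x0.
  by move=> nAx /esym/kP[<- /sepxx|].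
have [w3 w3P] : exists w, forall n, [set: nat] n -> forall x, k x = n ->
    ~ A v x -> exists a, [/\ A w a, ~ sep (A v) a x & a <= x].
  apply: (omega1_uniform omW (countableP _)).
    move=> n w u wu h x kx /(h x kx)[a [Aa ns ax]]; exists a; split=> //.
    exact: Amon Aa.
  move=> n _; have [[x0 kx0]|nx] := pselect (exists x0, k x0 = n); last first.
    by exists v => x kx; case: nx; exists x.
  have [w wP] := bounded_coinitial [set z | ~ sep (A v) z x0].
  exists w => x kx nAx; have nx : ~ sep (A v) x x0 by apply: class; rewrite ?kx.
  have [a [/= na Aa ax]] := wP x nx; exists a; split=> //.
  by move=> /(@sep_trans _ _ _ a x0 x)[|/sepC].
have [w4 w4P] : exists w, forall n, [set: nat] n -> forall x, k x = n ->
    ~ A v x -> exists a, [/\ A w a, ~ sep (A v) a x & x <= a].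
  apply: (omega1_uniform omW (countableP _)).
    move=> n w u wu h x kx /(h x kx)[a [Aa ns ax]]; exists a; split=> //.
    exact: Amon Aa.
  move=> n _; have [[x0 kx0]|nx] := pselect (exists x0, k x0 = n); last first.
    by exists v => x kx; case: nx; exists x.
  have [w wP] := bounded_cofinal [set z | ~ sep (A v) z x0].
  exists w => x kx nAx; have nx : ~ sep (A v) x x0 by apply: class; rewrite ?kx.
  have [a [/= na Aa ax]] := wP x nx; exists a; split=> //.
  by move=> /(@sep_trans _ _ _ a x0 x)[|/sepC].
exists (Order.max (Order.max w1 w2) (Order.max w3 w4)); split.
- move=> c x /w1P h /h[a Aa ax]; exists a => //; apply: Amon Aa.
  by rewrite !le_max lexx.
- move=> c x /w2P h /h[a Aa ax]; exists a => //; apply: Amon Aa.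
  by rewrite !le_max lexx orbT.
- move=> x /(w3P _ I x erefl)[a [Aa ns ax]]; exists a; split=> //.
  by apply: Amon Aa; rewrite !le_max lexx !orbT.
- move=> x /(w4P _ I x erefl)[a [Aa ns ax]]; exists a; split=> //.
  by apply: Amon Aa; rewrite !le_max lexx !orbT.
Qed.

(** Only [fil_step] is not immediate.  The least level z that separates x and u is a
    closure point; the separating point appears at some v < z, so no level lies
    strictly between v and z.  The supremum h of the levels below z is then itself a
    level, because a supremum of closure points is a closure point, and it is the
    predecessor of z. *)
Lemma levels_filtration (F : W -> W) :
    (forall w x, (forall v, w <= v) -> ~ A w x) ->
    (forall v, dense_over v (F v)) ->
  filtration (levels F) A.
Proof.
move=> A0 FP; have [Ac Amon Acov Alim] := decA.
have split_level z c : levels F z -> A z c -> closed_below F z /\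
    exists2 v, v < z & A v c.
  case=> [cz|zmin] Azc; last by case: (A0 z c zmin).
  split=> //; have [zl _] := cz.
  by move: Azc; rewrite (Alim _ zl) => -[v /= vz Avc]; exists v.
have over h z : levels F z -> h < z -> dense_over h z.
  move=> [[_ cz]|zmin] hz; first by apply: dense_over_mono (FP h); apply/ltW/cz.
  by move: hz; rewrite ltNge zmin.
split.
- exact: Amon.
- move=> x u; have [z [Ez sz] zl] : exists2 z, levels F z /\ sep (A z) x u &
      forall v, levels F v /\ sep (A v) x u -> z <= v.
    apply: (omega1_least omW (Q := [set z | levels F z /\ sep (A z) x u])).
    have [w Aw] := dec_cover x; have [z wz Ez] := levels_unbounded F w.
    by exists z; split=> //; apply: sep_l; apply: Amon Aw; apply: ltW.
  have below k : levels F k -> k < z -> ~ sep (A k) x u.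
    by move=> Ek kz sk; have := zl k (conj Ek sk); rewrite leNgt kz.
  have [c Ac' cP] := sz; have [[_ cz] [v vz Avc]] := split_level z c Ez Ac'.
  have nov k : levels F k -> k < z -> k <= v.
    move=> Ek kz; rewrite leNgt; apply/negP => vk; apply: (below k Ek kz).
    by exists c => //; apply: Amon Avc; apply: ltW.
  have [h hP hl] : exists2 h, (forall k, levels F k -> k < z -> k <= h) &
      forall h', (forall k, levels F k -> k < z -> k <= h') -> h <= h'.
    apply: (omega1_least omW (Q := [set h | forall k, levels F k -> k < z -> k <= h])).
    by exists v.
  have hz : h < z by apply: le_lt_trans vz; apply: hl.
  have Eh : levels F h.
    apply: contrapT => nEh; apply: (nEh); left.
    have down w : w < h -> exists k, [/\ closed_below F k, w < k & k < h].
      move=> wh; apply: contrapT => nk.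
      have : h <= w; last by rewrite leNgt wh.
      apply: hl => k Ek kz; rewrite leNgt; apply/negP => wk; apply: nk; exists k.
      split=> //; first by case: Ek => // kmin; rewrite ltNge kmin in wk.
      rewrite lt_neqAle hP// andbT; apply/eqP => kh; by rewrite kh in Ek.
    split; last by move=> w /down[k [[_ ck] wk kh]]; apply: lt_trans kh; apply: ck.
    split; last by move=> w /down[k [_ wk kh]]; exists k.
    apply: contrapT => nv; apply: nEh; right => w; rewrite leNgt; apply/negP => wh.
    by apply: nv; exists w.
  exists h, z; split=> //; last exact: below.
  split=> // k Ek; case: (ltP k z) => kz; [left|by right].
  exact: hP.
- move=> z c x Ez Azc cx; have [_ [v vz Avc]] := split_level z c Ez Azc.
  by have [h _ _ _] := over v z Ez vz; apply: h.
- move=> z c x Ez Azc cx; have [_ [v vz Avc]] := split_level z c Ez Azc.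
  by have [_ h _ _] := over v z Ez vz; apply: h.
- by move=> h z x _ Ez hz; have [_ _ + _] := over h z Ez hz; apply.
- by move=> h z x _ Ez hz; have [_ _ _ +] := over h z Ez hz; apply.
Qed.

(** Close off simultaneously under the given function and under passing to the next
    level: the result is a limit of levels. *)
Lemma levels_reflect (F G : W -> W) : exists d,
  [/\ levels F d, exists v, v < d, forall w, w < d -> G w < d,
      forall w, w < d -> exists2 k, levels F k & w < k < d &
      forall x, A d x -> exists2 w, w < d & A w x].
Proof.
have /choice[H HP] : forall w, exists v, w < v /\ levels F v.
  by move=> w; have [v] := levels_unbounded F w; exists v.
have [w0 _] := omega1_bound omW (countable0 W).
have [z _ [zl cz]] := closed_below_exists omW
  (fun w => Order.max (F w) (Order.max (G w) (H w))) w0.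
have cz' w : w < z -> [/\ F w < z, G w < z & H w < z].
  by move/cz; rewrite !gt_max => /and3P[].
exists z; split.
- by left; split=> // w /cz'[].
- by case: zl.
- by move=> w /cz'[].
- move=> w /cz'[_ _ Hz]; have [wH EH] := HP w; exists (H w) => //.
  by rewrite wH.
- case: decA => _ _ _ Alim x; rewrite Alim// => -[v /= vz Av].
Qed.

End Line.

Section Chains.
Context d (C : orderType d) d' (C' : orderType d').
Context (A : W -> set C) (A' : W -> set C').
Context (K0 : nat -> C -> C -> Prop) (K0' : nat -> C' -> C' -> Prop).
Hypothesis (cover0 : chain_cover K0) (cover0' : chain_cover K0').
Hypothesis (decA : is_decomposition A) (decA' : is_decomposition A').
Context (K : nat -> C -> C' -> Prop).

Lemma chains_over_mono v u w : u <= w ->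
  chains_over A A' K v u -> chains_over A A' K v w.
Proof.
have [_ Amon _ _] := decA; have [_ Amon' _ _] := decA'.
move=> uw [h1 h2 h3]; split=> n c x y Avc Kx xc.
- have [x1 [y1 [k1 k2 k3 k4]]] := h1 n c x y Avc Kx xc.
  by exists x1, y1; split=> //; apply: Amon' k3.
- have [x1 [y1 [k1 k2 k3 k4]]] := h2 n c x y Avc Kx xc.
  by exists x1, y1; split=> //; apply: Amon k3.
- have [x1 [y1 [k1 k2 k3 k4]]] := h3 n c x y Avc Kx xc.
  by exists x1, y1; split=> //; apply: Amon k3.
Qed.

Lemma chains_over_exists v : exists w, chains_over A A' K v w.
Proof.
have [Ac Amon _ _] := decA; have [Ac' Amon' _ _] := decA'.
have [w1 w1P] : exists w, forall nc : nat * C, ([set: nat] `*` A v) nc ->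
    forall x y, K nc.1 x y -> x <= nc.2 ->
    exists x1 y1, [/\ K nc.1 x1 y1, x1 <= nc.2, A' w y1 & y <= y1].
  apply: (omega1_uniform omW (countableX (countableP _) (Ac v))).
    move=> nc w u wu h x y Kx /(h x y Kx)[x1 [y1 [h1 h2 h3 h4]]].
    by exists x1, y1; split=> //; apply: Amon' h3.
  move=> [n c] [_ /= Avc].
  have [w wP] := bounded_cofinal cover0' decA'
    [set y | exists2 x, K n x y & x <= c].
  exists w => x y Kx xc; have [|y1 [[x1 K1 x1c] A1 yy1]] := wP y; first by exists x.
  by exists x1, y1.
have [w2 w2P] : exists w, forall nc : nat * C', ([set: nat] `*` A' v) nc ->
    forall x y, K nc.1 x y -> y <= nc.2 ->
    exists x1 y1, [/\ K nc.1 x1 y1, y1 <= nc.2, A w x1 & x <= x1].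
  apply: (omega1_uniform omW (countableX (countableP _) (Ac' v))).
    move=> nc w u wu h x y Kx /(h x y Kx)[x1 [y1 [h1 h2 h3 h4]]].
    by exists x1, y1; split=> //; apply: Amon h3.
  move=> [n c] [_ /= Avc].
  have [w wP] := bounded_cofinal cover0 decA
    [set x | exists2 y, K n x y & y <= c].
  exists w => x y Kx xc; have [|x1 [[y1 K1 x1c] A1 yy1]] := wP x; first by exists y.
  by exists x1, y1.
have [w3 w3P] : exists w, forall nc : nat * C', ([set: nat] `*` A' v) nc ->
    forall x y, K nc.1 x y -> nc.2 <= y ->
    exists x1 y1, [/\ K nc.1 x1 y1, nc.2 <= y1, A w x1 & x1 <= x].
  apply: (omega1_uniform omW (countableX (countableP _) (Ac' v))).
    move=> nc w u wu h x y Kx /(h x y Kx)[x1 [y1 [h1 h2 h3 h4]]].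
    by exists x1, y1; split=> //; apply: Amon h3.
  move=> [n c] [_ /= Avc].
  have [w wP] := bounded_coinitial cover0 decA
    [set x | exists2 y, K n x y & c <= y].
  exists w => x y Kx xc; have [|x1 [[y1 K1 x1c] A1 yy1]] := wP x; first by exists y.
  by exists x1, y1.
exists (Order.max w1 (Order.max w2 w3)); split=> n c x y Av Kx xc.
- have [x1 [y1 [h1 h2 h3 h4]]] := w1P (n, c) (conj I Av) x y Kx xc.
  by exists x1, y1; split=> //; apply: Amon' h3; rewrite !le_max lexx.
- have [x1 [y1 [h1 h2 h3 h4]]] := w2P (n, c) (conj I Av) x y Kx xc.
  by exists x1, y1; split=> //; apply: Amon h3; rewrite !le_max lexx orbT.
- have [x1 [y1 [h1 h2 h3 h4]]] := w3P (n, c) (conj I Av) x y Kx xc.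
  by exists x1, y1; split=> //; apply: Amon h3; rewrite !le_max lexx !orbT.
Qed.

Lemma levels_chains (F : W -> W) :
    (forall w x, (forall v, w <= v) -> ~ A w x) ->
    (forall w y, (forall v, w <= v) -> ~ A' w y) ->
    (forall v, chains_over A A' K v (F v)) ->
  forall w, levels F w -> chains_over A A' K w w.
Proof.
move=> A0 A0' FP w Ew.
have [_ _ _ Alim] := decA; have [_ _ _ Alim'] := decA'.
case: Ew => [[wl cw]|wmin]; last first.
  by split=> n c x y; [move/(A0 w c wmin)|move/(A0' w c wmin)|move/(A0' w c wmin)].
split=> n c x y.
- rewrite {1}Alim// => -[v /= vw Av].
  by have [h _ _] := chains_over_mono (ltW (cw v vw)) (FP v); apply: h.
- rewrite {1}Alim'// => -[v /= vw Av].
  by have [_ h _] := chains_over_mono (ltW (cw v vw)) (FP v); apply: h.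
- rewrite {1}Alim'// => -[v /= vw Av].
  by have [_ _ h] := chains_over_mono (ltW (cw v vw)) (FP v); apply: h.
Qed.

End Chains.
End Levels.

(** * The epimorphism *)

Lemma aleph1_dense_codense dW (W : orderType dW) d (C : orderType d)
    (B : set C) : is_omega1 W -> aleph1_dense W C -> countable B ->
  forall a b, a < b -> exists2 x, a < x < b & ~ B x.
Proof.
move=> [_ Wunc _] [_ _ _ dense] Bc a b ab; apply: contrapT => nx; apply: Wunc.
have := dense a b ab; rewrite card_eq_le => /andP[_ Wle].
apply: sub_countable Wle _.
have : countable (B `|` ([set a] `|` [set b])).
  by do !apply: countable_setU => //; exact: countable1.
apply: sub_countable; apply: subset_card_le => x /= /andP[ax xb].
have [Bx|nBx] := pselect (B x); [by left|right].
move: ax xb; rewrite !le_eqVlt => /orP[/eqP ->|ax]; first by left.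
move=> /orP[/eqP ->|xb]; first by right.
by case: nx; exists x; rewrite ?ax.
Qed.

Theorem theorem1p10 (dW dC dC' : Order.disp_t)
    (W : orderType dW) (C : orderType dC) (C' : orderType dC')
    (D : W -> set C) (D' : W -> set C') :
  is_omega1 W -> MA_aleph1 W ->
  aleph1_dense W C -> is_countryman C ->
  aleph1_dense W C' -> is_countryman C' ->
  embeds C' C ->
  is_decomposition D -> is_decomposition D' ->
  (exists E : set W,
     [/\ is_club E,
         some_left D `&` E `<=` every_left D'
       & some_right D `&` E `<=` every_right D']) ->
  epi_image C' C.
Proof.
move=> omW MA denC cC denC' cC' [e einj emon] decD decD' [E0 [[E0unb E0lim] HL HR]].
right.
have [K0 cover0] := countryman_cover cC; have [K0' cover0'] := countryman_cover cC'.
pose K n x y := K0 n x (e y).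
have ele x y : e x <= e y -> x <= y.
  move=> exy; rewrite leNgt; apply/negP => yx.
  have exy' : e x = e y by apply/eqP; rewrite eq_le exy emon// ltW.
  by move: yx; rewrite (einj _ _ exy') ltxx.
have Kchain n : chain_rel (K n).
  move=> x y x' y' h1 h2; have [Kch _] := cover0.
  by case: (Kch n _ _ _ _ h1 h2) => -[h3 /ele h4]; [left|right].
have Kcov x y : exists n, K n x y by have [_ cov] := cover0; apply: cov.
pose A := trim D; pose A' := trim D'.
have decA : is_decomposition A by apply: trim_decomposition.
have decA' : is_decomposition A' by apply: trim_decomposition.
have A0 w x : (forall v, w <= v) -> ~ A w x by apply: trim_min.
have A0' w x : (forall v, w <= v) -> ~ A' w x by apply: trim_min.
have [Ac Amon Acov _] := decA; have [Ac' Amon' Acov' _] := decA'.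
have /choice[F FP] : forall v, exists w, [/\ dense_over A v w, dense_over A' v w,
    chains_over A A' K v w & exists2 u, E0 u & v < u <= w].
  move=> v; have [w1 w1P] := dense_over_exists omW cover0 decA v.
  have [w2 w2P] := dense_over_exists omW cover0' decA' v.
  have [w3 w3P] := chains_over_exists omW cover0 cover0' decA decA' K v.
  have [v' vv'] := omega1_above omW v; have [u v'u E0u] := E0unb v'.
  exists (Order.max (Order.max w1 w2) (Order.max w3 u)).
  split.
  - by apply: (dense_over_mono decA) w1P; rewrite !le_max lexx.
  - by apply: (dense_over_mono decA') w2P; rewrite !le_max lexx !orbT.
  - by apply: (chains_over_mono decA decA') w3P; rewrite !le_max lexx !orbT.
  - by exists u => //; rewrite (lt_le_trans vv' v'u) !le_max lexx !orbT.
pose E := levels F.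
have filA : filtration E A.
  by apply: (levels_filtration omW decA A0) => v; case: (FP v).
have filA' : filtration E A'.
  by apply: (levels_filtration omW decA' A0') => v; case: (FP v).
have chE w : E w -> chains_over A A' K w w.
  by apply: (levels_chains decA decA' A0 A0') => v; case: (FP v).
have EE0 w : closed_below F w -> E0 w.
  move=> [wl cw]; apply: E0lim => // v vw; have [_ _ _ [u E0u /andP[vu uF]]] := FP v.
  by exists u => //; rewrite (ltW vu) (le_lt_trans uF (cw v vw)).
have codense w a b : a < b -> exists2 x, a < x < b & ~ A w x.
  by apply: (aleph1_dense_codense omW denC (Ac w)).
have leftE w : E w -> (exists x, leftend (A w) x) ->
    forall y, ~ A' w y -> exists2 y0, leftend (A' w) y0 & ~ sep (A' w) y0 y.
  case=> [cw|wmin].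
    have [wl _] := cw; apply: endpoint_transfer; rewrite /A /A' !trim_limit//.
    by move=> sw; apply: HL; split=> //; apply: EE0.
  move=> [x [_ xl]]; case: denC => _ nl _ _; case: nl; exists x; split=> // z _.
  by rewrite leNgt; apply/negP => /xl [c /(A0 w c wmin)].
have rightE w : E w -> (exists x, rightend (A w) x) ->
    forall y, ~ A' w y -> exists2 y0, rightend (A' w) y0 & ~ sep (A' w) y0 y.
  case=> [cw|wmin].
    have [wl _] := cw; apply: endpoint_transfer_right; rewrite /A /A' !trim_limit//.
    by move=> sw; apply: HR; split=> //; apply: EE0.
  move=> [x [_ xl]]; case: denC => _ _ nl _; case: nl; exists x; split=> // z _.
  by rewrite leNgt; apply/negP => /xl [c /(A0 w c wmin)].
pose N : set (set (C * C')) :=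
  range (fun x => [set t : C * C' | t.1 = x]) `|`
  range (fun y => [set t : C * C' | t.2 = y]).
have Ncard : N #<= [set: W].
  pose B w : set (set (C * C')) :=
    (fun x => [set t : C * C' | t.1 = x]) @` A w `|`
    (fun y => [set t : C * C' | t.2 = y]) @` A' w.
  have -> : N = \bigcup_w B w.
    apply/seteqP; split=> [X|X [w _ []]].
    - case=> -[z _ <-].
        by have [w Aw] := dec_cover decA z; exists w => //; left; exists z.
      by have [w Aw] := dec_cover decA' z; exists w => //; right; exists z.
    - by move=> [z _ <-]; left; exists z.
    - by move=> [z _ <-]; right; exists z.
  apply: card_le_omega1 => // [w|v w vw X].
    apply: countable_setU; first by apply: sub_countable (Ac w); exact: card_image_le.
    by apply: sub_countable (Ac' w); exact: card_image_le.
  case=> -[z Az <-]; first by left; exists z => //; apply: Amon Az.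
  by right; exists z => //; apply: Amon' Az.
have [R Rok RN] : exists2 R : set (C * C'),
    (forall s t, R s -> R t -> admissible E A A' s t) & forall X, N X -> R `&` X !=set0.
  apply: (MA_cliques MA Ncard).
    apply: (@admissible_knaster _ W _ C _ C' E A A' omW filA filA' K Kchain Kcov) => //.
    - by move=> w; apply: same_code cover0 (Ac w).
    - by move=> w; apply: same_code cover0' (Ac' w).
    - by move=> G; apply: levels_reflect.
  (* the extension lemmas start from a nonempty clique *)
  have [[x1 y1] ok1] : exists t : C * C', clique (admissible E A A') [:: t].
    case: denC' => [[y _]] _ _ _.
    have [_ [w [[_ Ew _ _] _ /sepxx Awy]]] := fil_step filA' y y.
    case: denC => [[a _]] _ noR _.
    have [b ab] : exists b, a < b.
      apply: contrapT => nb; apply: noR; exists a; split=> // z _.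
      by rewrite leNgt; apply/negP => az; apply: nb; exists z.
    have [x _ nAx] := codense w a b ab.
    have [en lv] := high_level filA filA' Ew Awy nAx.
    by exists (x, y); apply: clique_cons => //; apply: admissible_self.
  move=> p X cp [] [z _ <-].
    have [-> | p0] := eqVneq p [::].
      have [//|y cy] := extend_dom filA filA' leftE rightE z ok1.
      exists (z, y) => // s t; rewrite !inE => /eqP -> /eqP ->.
      by apply: cy; rewrite inE eqxx.
    by have [y cy] := extend_dom filA filA' leftE rightE z cp p0; exists (z, y).
  have [-> | p0] := eqVneq p [::].
    have [//|x cx] := extend_ran filA filA' codense z ok1.
    exists (x, z) => // s t; rewrite !inE => /eqP -> /eqP ->.
    by apply: cx; rewrite inE eqxx.
  by have [x cx] := extend_ran filA filA' codense z cp p0; exists (x, z).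
have /choice[f fP] : forall x, exists y, R (x, y).
  move=> x; have [|[x' y] [Rt /= <-]] := RN [set t | t.1 = x].
    by left; exists x.
  by exists y.
exists f; split.
  move=> y; have [|[x y'] [Rt /= <-]] := RN [set t | t.2 = y].
    by right; exists y.
  exists x; have [_ _ /= [h1 h2] _ _] := Rok _ _ (fP x) Rt.
  by apply/eqP; rewrite eq_le h1 ?h2.
by move=> x x' xx'; have [_ _ /= [h1 _] _ _] := Rok _ _ (fP x) (fP x'); apply: h1.
Qed.
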